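(* Let $M$ be a compact proper biharmonic submanifold of dimension $m$ of the unit Euclidean sphere $\mathbb{S}^n$, with mean curvature vector field $H$ and Weingarten operator $A_H$ associated to $H$. Then either (i) there exists a point $p\in M$ such that $|A_H(p)|^2<m|H(p)|^2$, or (ii) $|A_H|^2=m|H|^2$ on $M$. In this case, $M$ has parallel mean curvature vector field (i.e. $\nabla^\perp H=0$) and $|H|\in(0,1]$.
   Context: All manifolds, metrics and maps are smooth, and all manifolds are connected. A map $\phi:(M,g)\to(N,h)$ between Riemannian manifolds has tension field $\tau(\phi)=\mathrm{trace}\,\nabla d\phi$; it is harmonic if $\tau(\phi)=0$, and biharmonic if $\tau_2(\phi)=-\Delta\tau(\phi)-\mathrm{trace}\,R^N(d\phi\cdot,\tau(\phi))d\phi\cdot=0$, where $\Delta V=-\mathrm{trace}\,\nabla^2V$ for sections $V$ of $\phi^{-1}(TN)$ and $R^N(X,Y)=[\nabla_X,\nabla_Y]-\nabla_{[X,Y]}$. A submanifold (with the induced metric) is called proper biharmonic if its inclusion map is biharmonic but not harmonic (i.e. the submanifold is not minimal). For a submanifold $M^m\subset\mathbb{S}^n$: $B$ is the second fundamental form, $H=\frac1m\,\mathrm{trace}\,B$ is the mean curvature vector field, $|H|$ is the mean curvature, $\nabla^\perp$ is the normal connection, and for a normal vector field $\eta$ the Weingarten operator $A_\eta$ is given by $\langle A_\eta(X),Y\rangle=\langle B(X,Y),\eta\rangle$. $|A_H|^2=\mathrm{trace}(A_H^2)$. *)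

(* Defs.v *)
From HB Require Import structures.
From mathcomp Require Import all_boot all_order all_algebra.
From mathcomp Require Import all_classical all_reals all_analysis.

Set Implicit Arguments.
Unset Strict Implicit.
Unset Printing Implicit Defensive.

Import Order.TTheory GRing.Theory Num.Theory.
Import numFieldNormedType.Exports.

Local Open Scope classical_set_scope.
Local Open Scope ring_scope.

Definition partial (R : realType) (m : nat) (W : normedModType R) (i : 'I_m)
  (F : 'rV[R]_m -> W) : 'rV[R]_m -> W := fun u => 'D_(delta_mx 0 i) F u.

Definition iter_partial (R : realType) (m : nat) (W : normedModType R)
  (s : seq 'I_m) (F : 'rV[R]_m -> W) : 'rV[R]_m -> W :=
  foldr (fun i G => partial i G) F s.

(* For [V] open: every iterated partial derivative exists and is continuous. *)
Definition smooth_on (R : realType) (m : nat) (W : normedModType R)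
  (V : set 'rV[R]_m) (F : 'rV[R]_m -> W) : Prop :=
  forall (s : seq 'I_m) (u : 'rV[R]_m), V u ->
    {for u, continuous (iter_partial s F)} /\
    forall i : 'I_m, derivable (iter_partial s F) u (delta_mx 0 i).

Record chart (R : realType) (m : nat) (M : topologicalType) := Chart {
  chart_dom : set M;
  chart_cod : set 'rV[R]_m;
  chart_map : M -> 'rV[R]_m;
  chart_inv : 'rV[R]_m -> M;
  chart_dom_open : open chart_dom;
  chart_cod_open : open chart_cod;
  chart_map_cod : forall p, chart_dom p -> chart_cod (chart_map p);
  chart_inv_dom : forall u, chart_cod u -> chart_dom (chart_inv u);
  chart_mapK : forall p, chart_dom p -> chart_inv (chart_map p) = p;
  chart_invK : forall u, chart_cod u -> chart_map (chart_inv u) = u;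
  chart_map_continuous : forall p, chart_dom p -> {for p, continuous chart_map};
  chart_inv_continuous : forall u, chart_cod u -> {for u, continuous chart_inv} }.

Record smoothManifold (R : realType) (m : nat) := SmoothManifold {
  carrier :> topologicalType;
  carrier_hausdorff : hausdorff_space carrier;
  carrier_second_countable : @second_countable carrier;
  carrier_connected : connected [set: carrier];
  atlas : set (chart R m carrier);
  atlas_cover : forall p : carrier, exists2 c, atlas c & chart_dom c p;
  atlas_smooth : forall c d, atlas c -> atlas d ->
    smooth_on [set u | chart_cod c u /\ chart_dom d (chart_inv c u)]
              (chart_map d \o chart_inv c) }.

(** The norm of the library on ['rV] is the sup norm, hence [dot] and
    [enorm].  A map into the sphere is a map into ['rV_n.+1] with values in
    [unit_sphere]; tangent vectors of the sphere at [y] are the vectors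
    orthogonal to [y]; the Levi-Civita connection of the sphere is the
    tangential part of the flat derivative. *)

Definition dot (R : realType) (k : nat) (v w : 'rV[R]_k) : R :=
  \sum_i v 0 i * w 0 i.

Definition enorm (R : realType) (k : nat) (v : 'rV[R]_k) : R :=
  Num.sqrt (dot v v).

Definition unit_sphere (R : realType) (n : nat) : set 'rV[R]_n.+1 :=
  [set y | enorm y = 1].

Definition sphere_proj (R : realType) (n : nat) (y w : 'rV[R]_n.+1) :
  'rV[R]_n.+1 := w - dot w y *: y.

Definition sphere_nabla (R : realType) (n : nat)
  (X Z : 'rV[R]_n.+1 -> 'rV[R]_n.+1) : 'rV[R]_n.+1 -> 'rV[R]_n.+1 :=
  fun y => sphere_proj y ('D_(X y) Z y).

Definition lie_bracket (R : realType) (n : nat)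
  (X Y : 'rV[R]_n.+1 -> 'rV[R]_n.+1) : 'rV[R]_n.+1 -> 'rV[R]_n.+1 :=
  fun y => 'D_(X y) Y y - 'D_(Y y) X y.

(* [R(v1, v2) v3] at [y], computed as the commutator on the fields
   [z |-> sphere_proj z vi], which are tangent to the sphere and take the
   value [vi] at [y] when [vi] is tangent at [y]. *)
Definition sphere_curvature (R : realType) (n : nat)
  (y v1 v2 v3 : 'rV[R]_n.+1) : 'rV[R]_n.+1 :=
  let X := (fun z => sphere_proj z v1) in
  let Y := (fun z => sphere_proj z v2) in
  let Z := (fun z => sphere_proj z v3) in
  sphere_nabla X (sphere_nabla Y Z) y - sphere_nabla Y (sphere_nabla X Z) y
  - sphere_nabla (lie_bracket X Y) Z y.

(** In the local formulas below, [g u] is the matrix of the metric in the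
    coordinate frame, [F] is the map and [V] a section of the pull-back of the tangent bundle of the sphere,
    both read in the chart. *)

Definition christoffel (R : realType) (m : nat) (g : 'rV[R]_m -> 'M[R]_m)
  (k i j : 'I_m) (u : 'rV[R]_m) : R :=
  2^-1 * \sum_l invmx (g u) k l *
    (partial i (fun z => g z j l) u + partial j (fun z => g z i l) u
     - partial l (fun z => g z i j) u).

Definition metric_trace (R : realType) (m : nat) (W : normedModType R)
  (G : 'M[R]_m) (T : 'I_m -> 'I_m -> W) : W :=
  \sum_i \sum_j invmx G i j *: T i j.

Definition pullback_nabla (R : realType) (m n : nat)
  (F : 'rV[R]_m -> 'rV[R]_n.+1) (i : 'I_m) (V : 'rV[R]_m -> 'rV[R]_n.+1) :
  'rV[R]_m -> 'rV[R]_n.+1 := fun u => sphere_proj (F u) (partial i V u).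

(* [(nabla d F)(d_i, d_j)] *)
Definition nabla_d (R : realType) (m n : nat) (g : 'rV[R]_m -> 'M[R]_m)
  (F : 'rV[R]_m -> 'rV[R]_n.+1) (u : 'rV[R]_m) (i j : 'I_m) : 'rV[R]_n.+1 :=
  pullback_nabla F i (partial j F) u
  - \sum_k christoffel g k i j u *: partial k F u.

(* [(nabla^2 V)(d_i, d_j)] *)
Definition nabla2 (R : realType) (m n : nat) (g : 'rV[R]_m -> 'M[R]_m)
  (F V : 'rV[R]_m -> 'rV[R]_n.+1) (u : 'rV[R]_m) (i j : 'I_m) :
  'rV[R]_n.+1 :=
  pullback_nabla F i (pullback_nabla F j V) u
  - \sum_k christoffel g k i j u *: pullback_nabla F k V u.

Definition tension (R : realType) (m n : nat) (g : 'rV[R]_m -> 'M[R]_m)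
  (F : 'rV[R]_m -> 'rV[R]_n.+1) (u : 'rV[R]_m) : 'rV[R]_n.+1 :=
  metric_trace (g u) (nabla_d g F u).

Definition rough_laplacian (R : realType) (m n : nat)
  (g : 'rV[R]_m -> 'M[R]_m) (F V : 'rV[R]_m -> 'rV[R]_n.+1)
  (u : 'rV[R]_m) : 'rV[R]_n.+1 :=
  - metric_trace (g u) (nabla2 g F V u).

Definition bitension (R : realType) (m n : nat) (g : 'rV[R]_m -> 'M[R]_m)
  (F : 'rV[R]_m -> 'rV[R]_n.+1) (u : 'rV[R]_m) : 'rV[R]_n.+1 :=
  - rough_laplacian g F (tension g F) u
  - metric_trace (g u) (fun i j =>
      sphere_curvature (F u) (partial i F u) (tension g F u) (partial j F u)).

(** A metric on [M] is given by its matrix [g c] in every chart [c]. *)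

Definition harmonic (R : realType) (m n : nat) (M : smoothManifold R m)
  (g : chart R m M -> 'rV[R]_m -> 'M[R]_m) (f : M -> 'rV[R]_n.+1) : Prop :=
  forall c u, atlas c -> chart_cod c u -> tension (g c) (f \o chart_inv c) u = 0.

Definition biharmonic (R : realType) (m n : nat) (M : smoothManifold R m)
  (g : chart R m M -> 'rV[R]_m -> 'M[R]_m) (f : M -> 'rV[R]_n.+1) : Prop :=
  forall c u, atlas c -> chart_cod c u -> bitension (g c) (f \o chart_inv c) u = 0.

(** A submanifold of the sphere is given by its inclusion map [f], a smooth
    immersion with values in the sphere; [f] need not be injective. *)

(* The rows are the coordinate tangent vectors. *)
Definition tangent_frame (R : realType) (m n : nat)
  (F : 'rV[R]_m -> 'rV[R]_n.+1) (u : 'rV[R]_m) : 'M[R]_(m, n.+1) :=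
  \matrix_(i < m) partial i F u.

Definition sphere_submanifold (R : realType) (m n : nat)
  (M : smoothManifold R m) (f : M -> 'rV[R]_n.+1) : Prop :=
  (forall p, unit_sphere (f p)) /\
  forall c, atlas c ->
    smooth_on (chart_cod c) (f \o chart_inv c) /\
    forall u, chart_cod c u -> row_free (tangent_frame (f \o chart_inv c) u).

Definition first_form (R : realType) (m n : nat)
  (F : 'rV[R]_m -> 'rV[R]_n.+1) (u : 'rV[R]_m) : 'M[R]_m :=
  \matrix_(i, j) dot (partial i F u) (partial j F u).

Definition induced_metric (R : realType) (m n : nat) (M : smoothManifold R m)
  (f : M -> 'rV[R]_n.+1) (c : chart R m M) : 'rV[R]_m -> 'M[R]_m :=
  first_form (f \o chart_inv c).

Definition proper_biharmonic (R : realType) (m n : nat)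
  (M : smoothManifold R m) (f : M -> 'rV[R]_n.+1) : Prop :=
  biharmonic (induced_metric f) f /\ ~ harmonic (induced_metric f) f.

(* Orthogonal projection onto the normal space of the submanifold in the
   tangent space of the sphere at [F u]. *)
Definition normal_proj (R : realType) (m n : nat)
  (F : 'rV[R]_m -> 'rV[R]_n.+1) (u : 'rV[R]_m) (w : 'rV[R]_n.+1) :
  'rV[R]_n.+1 :=
  sphere_proj (F u) w
  - metric_trace (first_form F u)
      (fun i j => dot w (partial i F u) *: partial j F u).

Definition second_form (R : realType) (m n : nat)
  (F : 'rV[R]_m -> 'rV[R]_n.+1) (u : 'rV[R]_m) (i j : 'I_m) : 'rV[R]_n.+1 :=
  normal_proj F u (pullback_nabla F i (partial j F) u).

Definition mean_curvature (R : realType) (m n : nat)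
  (F : 'rV[R]_m -> 'rV[R]_n.+1) (u : 'rV[R]_m) : 'rV[R]_n.+1 :=
  m%:R^-1 *: metric_trace (first_form F u) (second_form F u).

(* Row [i] holds the components of [A_eta d_i] in the coordinate frame: this
   is the unique solution [A] of
   [A *m first_form F u = \matrix_(i, j) <B(d_i, d_j), eta>]. *)
Definition weingarten (R : realType) (m n : nat)
  (F : 'rV[R]_m -> 'rV[R]_n.+1) (u : 'rV[R]_m) (eta : 'rV[R]_n.+1) :
  'M[R]_m :=
  (\matrix_(i, j) dot (second_form F u i j) eta) *m invmx (first_form F u).

Definition normal_nabla (R : realType) (m n : nat)
  (F : 'rV[R]_m -> 'rV[R]_n.+1) (i : 'I_m)
  (eta : 'rV[R]_m -> 'rV[R]_n.+1) (u : 'rV[R]_m) : 'rV[R]_n.+1 :=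
  normal_proj F u (pullback_nabla F i eta u).

(* [|A_H|^2] *)
Definition sqnorm_AH (R : realType) (m n : nat)
  (F : 'rV[R]_m -> 'rV[R]_n.+1) (u : 'rV[R]_m) : R :=
  let A := weingarten F u (mean_curvature F u) in \tr (A *m A).

Definition parallel_mean_curvature (R : realType) (m n : nat)
  (M : smoothManifold R m) (f : M -> 'rV[R]_n.+1) : Prop :=
  forall c u i, atlas c -> chart_cod c u ->
    normal_nabla (f \o chart_inv c) i (mean_curvature (f \o chart_inv c)) u = 0.

(* Main.v *)
Require Import Defs.
From HB Require Import structures.
From mathcomp Require Import all_boot all_order all_algebra.
From mathcomp Require Import all_classical all_reals all_analysis.
From mathcomp Require Import ring lra.

(** Write [tau = m H] for the tension field of the inclusion.  It is normal to
    [M], the sphere has constant curvature 1, and so the biharmonic equation says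
    that the rough Laplacian [trace nabla^2 tau] equals [- m tau].  Splitting the
    derivative of [tau] into its tangential part [- A_tau] and its normal part,
    one gets Bochner's formula
      [Delta |tau|^2 = 2 (|A_tau|^2 - m |tau|^2 + |nabla^perp tau|^2)],
    where [Delta] is [g^ij (d_i d_j - Gamma^k_ij d_k)] ([laplace_sqr_tau],
    [grad_tau_sqrE]).

    If (i) fails then [|A_H|^2 >= m |H|^2] everywhere and [|tau|^2] is subharmonic.
    On a compact connected manifold it is then constant.  This is obtained from
    the strong maximum principle of Hopf ([strong_max]), used in charts, rather
    than by integration: the set where [|H|^2] takes its maximum is open and
    closed ([sqr_mean_curvature_constant]).  With a constant [|tau|^2] the right
    hand side of Bochner's formula vanishes, so both of its nonnegative terms
    [|A_tau|^2 - m |tau|^2] and [|nabla^perp tau|^2] do ([constant_tau2]): this is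
    the equality in (ii) and the parallelism of [H].  The constant is positive
    because [M] is not minimal, and since [trace A_H = m |H|^2] the Cauchy-Schwarz
    inequality [(trace A_H)^2 <= m |A_H|^2 = m^2 |H|^2] gives [|H| <= 1]
    ([sqr_tr_invgram]).

    Everything is computed in coordinates.  To regard [|H|^2] as a function on
    [M], its independence of the chart is needed ([mean_curvature_reparam]); it
    holds because the second fundamental form is a tensor.  The metric is the
    Gram matrix [T T^T] of the coordinate frame [T], and
    [(T T^T)^-1 = Q Q^T] with [Q = (T T^T)^-1 T] exhibits the Laplacian as a sum of
    second derivatives along the columns of [Q], which is all the ellipticity that
    the maximum principle uses besides positive definiteness. *)


Set Implicit Arguments.
Unset Strict Implicit.
Unset Printing Implicit Defensive.

Import Order.TTheory GRing.Theory Num.Theory.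
Import numFieldNormedType.Exports.

Local Open Scope classical_set_scope.
Local Open Scope ring_scope.

(** * Derivatives along lines *)

Lemma is_derive_line (R : realType) (V W : normedModType R) (f : V -> W)
    (x v : V) (t : R) :
  derivable f (x + t *: v) v ->
  is_derive t 1 (fun s => f (x + s *: v)) ('D_v f (x + t *: v)).
Proof.
have gE : (fun h : R => h^-1 *: (((fun s => f (x + s *: v)) \o shift t) (h *: 1)
             - f (x + t *: v)))
        = (fun h : R => h^-1 *: ((f \o shift (x + t *: v)) (h *: v)
             - f (x + t *: v))).
  apply/funext => h /=; congr (_ *: (f _ - _)).
  by rewrite [h *: 1]mulr1 scalerDl addrCA.
by move=> df; split; rewrite /derivable /derive gE.
Qed.

Lemma derivable_line (R : realType) (V W : normedModType R) (f : V -> W)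
    (x v : V) : derivable f x v ->
  is_derive (0 : R) 1 (fun s => f (x + s *: v)) ('D_v f x).
Proof.
move=> df.
by have := @is_derive_line R V W f x v 0; rewrite scale0r addr0; apply.
Qed.

Lemma is_derive_comp_diff (R : realType) (U V W : normedModType R) (f : V -> W)
    (g : U -> V) (u w : U) :
  differentiable f (g u) -> derivable g u w ->
  is_derive u w (f \o g) ('d f (g u) ('D_w g u)).
Proof.
move=> df dg.
pose g1 (s : R) := g (u + s *: w).
have [dg1 g1E] := derivable_line dg.
have g10 : g1 0 = g u by rewrite /g1 scale0r addr0.
have dg1' : differentiable g1 0 by apply/derivable1_diffP.
have df1 : differentiable f (g1 0) by rewrite g10.
have d0 : derivable (f \o g1) 0 1.
  by apply/diff_derivable/differentiable_comp.
have E (h : R) : (f \o g1) (h *: 1 + 0) = (f \o g) (h *: w + u).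
  by rewrite /= /g1 addr0 [h *: 1]mulr1 addrC.
have E0 : (f \o g1) 0 = (f \o g) u by rewrite /= g10.
have gE : (fun h : R => h^-1 *: (((f \o g1) \o shift 0) (h *: 1) - (f \o g1) 0))
        = (fun h : R => h^-1 *: (((f \o g) \o shift u) (h *: w) - (f \o g) u)).
  by apply/funext => h; congr (_ *: (_ - _)); [exact: E|exact: E0].
split; first by rewrite /derivable -gE.
rewrite /derive -gE -[LHS]/('D_1 (f \o g1) 0) deriveE; last first.
  exact: differentiable_comp.
rewrite diff_comp // /= g10; congr ('d f _ _).
by rewrite -deriveE // g1E.
Qed.

(** The restriction of [f] to the line through [x] is a function of one variable,
    to which the chain rule applies although [f] itself need not be
    differentiable. *)
Lemma is_derive_dirZ (R : realType) (V W : normedModType R) (f : V -> W)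
    (x v : V) (h : R) :
  derivable f x v -> is_derive x (h *: v) f (h *: 'D_v f x).
Proof.
move=> df.
have [d1 d1E] := derivable_line df.
have := @is_derive_comp_diff R R R W (fun s => f (x + s *: v)) (fun t => t * h) 0 1.
rewrite mul0r => /(_ ((derivable1_diffP _ _).1 d1)).
have dh : is_derive (0 : R) 1 (fun t : R => t * h) h.
  have : is_derive (0 : R) 1 (id * cst h) ((0:R) *: 0 + h *: 1) by exact: is_deriveM.
  by rewrite scale0r add0r [h *: 1]mulr1.
move=> /(_ ex_derive); rewrite derive_val -[X in 'd _ _ X]mulr1 linearZ /=.
rewrite -deriveE; last exact/derivable1_diffP.
rewrite d1E => -[d2 d2E].
set F := (fun s => f (x + s *: v)) \o (fun t => t * h) in d2 d2E *.
have E (k : R) : F (k *: 1 + 0) = f (k *: (h *: v) + x).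
  by rewrite /F /= addr0 [k *: 1]mulr1 -scalerA addrC.
have F0 : F 0 = f x by rewrite /F /= mul0r scale0r addr0.
have gE : (fun k : R => k^-1 *: ((F \o shift 0) (k *: 1) - F 0))
        = (fun k : R => k^-1 *: ((f \o shift x) (k *: (h *: v)) - f x)).
  by apply/funext => k; congr (_ *: (_ - _)); [exact: E|exact: F0].
by split; [rewrite /derivable -gE|rewrite /derive -gE].
Qed.

Lemma MVT_line (R : realType) (V : normedModType R) (f : V -> R) (x v : V) :
  (forall t : R, 0 <= t <= 1 -> derivable f (x + t *: v) v) ->
  exists2 t : R, 0 < t < 1 & f (x + v) - f x = 'D_v f (x + t *: v).
Proof.
move=> df.
have [||t] := @MVT R (fun s => f (x + s *: v))
  (fun s => 'D_v f (x + s *: v)) 0 1 ltr01.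
- move=> s; rewrite in_itv /= => /andP[s0 s1].
  by apply: is_derive_line; apply: df; rewrite !ltW.
- apply: derivable_within_continuous => s; rewrite in_itv /= => s01.
  by have [] := is_derive_line (df s s01).
rewrite in_itv /= => t01.
rewrite scale1r scale0r addr0 subr0 mulr1 => fE.
by exists t.
Qed.

Lemma le_rVnorm (R : realType) (m : nat) (v : 'rV[R]_m) (j : 'I_m) :
  `|v 0 j| <= `|v|.
Proof.
rewrite [leRHS]/Num.Def.normr /= mx_normrE.
exact: (le_bigmax _ (fun i : 'I_1 * 'I_m => `|v i.1 i.2|) (0, j)).
Qed.

Lemma rVnorm_le (R : realType) (m : nat) (v : 'rV[R]_m) (c : R) :
  0 <= c -> (forall j, `|v 0 j| <= c) -> `|v| <= c.
Proof.
move=> c0 vc; rewrite /Num.Def.normr /= mx_normrE bigmax_le // => -[i j] _ /=.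
by rewrite (ord1 i).
Qed.

(** * Continuous partial derivatives and differentiability *)

Definition rV_trunc (R : realType) (m : nat) (h : 'rV[R]_m) (k : nat) :
  'rV[R]_m := \row_(j < m) if (j < k)%N then h 0 j else 0.

Definition grad_form (R : realType) (m : nat) (f : 'rV[R]_m -> R)
    (x h : 'rV[R]_m) : R := \sum_i h 0 i * partial i f x.

Section C1.
Variables (R : realType) (m : nat).
Implicit Types (f : 'rV[R]_m -> R) (x h : 'rV[R]_m).

Lemma grad_form_linear f x : linear (grad_form f x).
Proof.
move=> a u v; rewrite /grad_form scaler_sumr -big_split /=.
by apply: eq_bigr => i _; rewrite !mxE mulrDl -mulrA.
Qed.
HB.instance Definition _ f x :=
  GRing.isLinear.Build R 'rV[R]_m R _ (grad_form f x) (grad_form_linear f x).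

Lemma grad_form_continuous f x : continuous (grad_form f x).
Proof.
move=> u; apply: differentiable_continuous.
rewrite (_ : grad_form f x =
  \sum_i ((fun v : 'rV[R]_m => v 0 i) * cst (partial i f x))); last first.
  by apply/funext => v; rewrite /grad_form fct_sumE.
apply: differentiable_sum => i; apply: differentiableM.
  exact: differentiable_coord.
exact: differentiable_cst.
Qed.

(** The increment is a telescoping sum of increments parallel to the coordinate
    axes, and the mean value theorem estimates each of them. *)
Lemma grad_form_increment f x (e d : R) h :
  (forall y, `|y - x| < d ->
     forall i, derivable f y (delta_mx 0 i) /\
               `|partial i f y - partial i f x| <= e) ->
  `|h| < d -> `|f (x + h) - f x - grad_form f x h| <= m%:R * e * `|h|.
Proof.
move=> fd hd.
have trunc0 : rV_trunc h 0 = 0 by apply/rowP => j; rewrite !mxE.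
have truncm : rV_trunc h m = h by apply/rowP => j; rewrite !mxE ltn_ord.
have truncS (k : 'I_m) :
    rV_trunc h k.+1 = rV_trunc h k + h 0 k *: delta_mx 0 k.
  apply/rowP => j; rewrite !mxE eqxx /= ltnS leq_eqVlt.
  case: (eqVneq j k) => [->|jk]; first by rewrite eqxx ltnn /= mulr1 add0r.
  by rewrite -val_eqE /= in jk; rewrite (negbTE jk) /= mulr0 addr0.
have tele : f (x + h) - f x =
    \sum_(k < m) (f (x + rV_trunc h k.+1) - f (x + rV_trunc h k)).
  rewrite -(big_mkord xpredT
    (fun k => f (x + rV_trunc h k.+1) - f (x + rV_trunc h k))).
  by rewrite telescope_sumr // trunc0 truncm addr0.
rewrite tele /grad_form -sumrB.
apply: le_trans (ler_norm_sum _ _ _) _.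
rewrite -mulrA mulr_natl -[X in _ *+ X]card_ord -sumr_const.
apply: ler_sum => k _.
have near_x (t : R) : 0 <= t <= 1 ->
    `|x + rV_trunc h k + t *: (h 0 k *: delta_mx 0 k) - x| < d.
  move=> /andP[t0 t1]; apply: le_lt_trans hd.
  rewrite addrAC [x + _ - x]addrAC subrr add0r; apply: rVnorm_le => // j.
  rewrite !mxE eqxx /=.
  case: (eqVneq j k) => [->|jk].
    rewrite ltnn /= mulr1 add0r normrM ger0_norm //.
    by rewrite (le_trans _ (le_rVnorm h k)) // ler_piMl.
  by rewrite mulr0 mulr0 addr0; case: ifP => _; rewrite ?normr0 ?le_rVnorm.
have [t t01|t t01] := @MVT_line R _ f (x + rV_trunc h k) (h 0 k *: delta_mx 0 k).
  have [] := fd _ (near_x t t01) k.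
  by move=> /(is_derive_dirZ (h 0 k)) [].
rewrite truncS addrA => ->.
have t01' : 0 <= t <= 1 by case/andP: t01 => /ltW -> /ltW ->.
have [df dfle] := fd _ (near_x t t01') k.
rewrite (@derive_val _ _ _ _ _ _ _ (is_derive_dirZ (h 0 k) df)).
rewrite -/(partial k f _) -mulrBr normrM mulrC ler_pM //.
exact: le_rVnorm.
Qed.

Lemma is_diff_of_bound (V W : normedModType R) (f : V -> W)
    (df : {linear V -> W}) (x : V) :
  continuous df ->
  (forall e : R, 0 < e ->
     \forall h \near (0 : V), `|f (x + h) - f x - df h| <= e * `|h|) ->
  is_diff x f df.
Proof.
move=> dfc fe.
have key : f \o shift x = cst (f x) + df +o_ 0 id.
  apply/eqaddoP => e e0; apply: filterS (fe e e0) => h.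
  rewrite (_ : f (x + h) - f x - df h =
     (f \o shift x) h - (cst (f x) + df) h) //.
  by rewrite /= [h + x]addrC -!addrA opprD.
have E : 'd f x = df :> (_ -> _) by exact: diff_unique.
by split=> //; apply/diff_locallyP; rewrite E.
Qed.

(** Smoothness on a manifold speaks of partial derivatives, while the chain rule
    and derivatives in oblique directions call for the Frechet derivative. *)
Lemma C1_differentiable f x :
  (\forall y \near x, forall i, derivable f y (delta_mx 0 i)) ->
  (forall i, {for x, continuous (partial i f)}) ->
  is_diff x f (grad_form f x).
Proof.
move=> df cf.
apply: is_diff_of_bound; first exact: grad_form_continuous.
move=> e egt0.
have e0 : 0 < e / m.+1%:R by rewrite divr_gt0.
have : \forall y \near x, forall i, derivable f y (delta_mx 0 i) /\
               `|partial i f y - partial i f x| <= e / m.+1%:R.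
    have : \forall y \near x, forall i, `|partial i f y - partial i f x| <= e / m.+1%:R.
      apply: (@filter_forall _ _
        (fun i y => `|partial i f y - partial i f x| <= e / m.+1%:R)
        _ (nbhs_filter x)) => i.
      have /cvgrPdist_le /(_ _ e0) := cf i.
      by apply: filterS => y; rewrite distrC.
    by move: df; apply: filterS2 => y H1 H2 i; split.
  move=> /nbhs_ballP[d /= d0 dP].
  apply/nbhs_ballP; exists d => //= h.
  rewrite -ball_normE /= sub0r normrN => hd.
  apply: le_trans (@grad_form_increment f x (e / m.+1%:R) d h _ hd) _.
  move=> y yx i; apply: dP.
  by rewrite -ball_normE /= distrC.
rewrite ler_wpM2r // mulrCA ler_piMr //; first exact: ltW.
by rewrite ler_pdivrMr ?mul1r ?ler_nat // ltr0n.
Qed.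

End C1.

(** * Functions of class C^k on an open set *)

Section CkFunctions.
Variables (R : realType) (m : nat).
Implicit Types (f g : 'rV[R]_m -> R) (V : set 'rV[R]_m).

(** The recursion takes the innermost derivative first, so that the Leibniz rule
    gives stability under products by induction on [k]; [smooth_on] takes the
    outermost one first. *)
Fixpoint Ck (k : nat) V f : Prop :=
  match k with
  | 0 => forall u, V u -> {for u, continuous f}
  | k'.+1 => (forall u, V u -> {for u, continuous f} /\
                forall i, derivable f u (delta_mx 0 i)) /\
             forall i, Ck k' V (partial i f)
  end.

Lemma partial_congr (W : normedModType R) V (f g : 'rV[R]_m -> W) i u :
  open V -> (forall v, V v -> f v = g v) -> V u -> partial i f u = partial i g u.
Proof.
move=> Vo fg Vu; apply: near_eq_derive.
by apply: (filterS fg); exact: open_nbhs_nbhs.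
Qed.

Lemma derivable_congr (W : normedModType R) V (f g : 'rV[R]_m -> W) v u :
  open V -> (forall v, V v -> f v = g v) -> V u ->
  derivable f u v -> derivable g u v.
Proof.
move=> Vo fg Vu; apply: near_eq_derivable.
by apply: (filterS fg); exact: open_nbhs_nbhs.
Qed.

Lemma continuous_congr (T U : topologicalType) (V : set T) (f g : T -> U) u :
  open V -> (forall v, V v -> f v = g v) -> V u ->
  {for u, continuous f} -> {for u, continuous g}.
Proof.
move=> Vo fg Vu cf; rewrite /prop_for /continuous_at -fg //.
apply: cvg_trans cf; apply: near_eq_cvg.
by apply: (filterS fg); exact: open_nbhs_nbhs.
Qed.

Lemma Ck_congr k V f g : open V -> (forall u, V u -> f u = g u) ->
  Ck k V f -> Ck k V g.
Proof.
move=> Vo; elim: k f g => [|k IH] f g fg /=.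
  by move=> cf u Vu; exact: (continuous_congr Vo fg Vu (cf u Vu)).
move=> [cf pf]; split=> [u Vu|i].
  have [cu du] := cf u Vu; split; first exact: (continuous_congr Vo fg Vu cu).
  by move=> i; exact: (derivable_congr Vo fg Vu (du i)).
by apply: IH (pf i) => u Vu; exact: (partial_congr i Vo fg Vu).
Qed.

Lemma CkW k V f : Ck k.+1 V f -> Ck k V f.
Proof.
elim: k f => [|k IH] f; first by case=> cf _ u /cf[].
by move=> [cf pf]; split=> // i; exact: IH (pf i).
Qed.

Lemma Ck_sub k U V f : U `<=` V -> Ck k V f -> Ck k U f.
Proof.
move=> UV; elim: k f => [|k IH] f; first by move=> cf u /UV; exact: cf.
move=> [cf pf]; split=> [u Uu|i]; first exact: cf (UV u Uu).
exact: IH (pf i).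
Qed.

Lemma Ck_cont k V f u : Ck k V f -> V u -> {for u, continuous f}.
Proof.
case: k => [|k] /=; first by move=> cf; exact: cf.
by case=> cf _ /cf[].
Qed.

Lemma Ck_derivable k V f u i : Ck k.+1 V f -> V u ->
  derivable f u (delta_mx 0 i).
Proof. by move=> [cf _] Vu; have [_] := cf u Vu. Qed.

Lemma Ck_partial k V f i : Ck k.+1 V f -> Ck k V (partial i f).
Proof. by move=> [_ pf]; exact: pf. Qed.

Lemma Ck_is_diff k V f u : open V -> Ck k.+1 V f -> V u ->
  is_diff u f (grad_form f u).
Proof.
move=> Vo [cf pf] Vu; apply: C1_differentiable.
  have : \forall y \near u, V y by exact: open_nbhs_nbhs.
  by apply: filterS => y /cf[].
by move=> i; apply: Ck_cont (pf i) Vu.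
Qed.

Lemma Ck_cst k V c : Ck k V (fun=> c).
Proof.
elim: k c => [|k IH] c /=; first by move=> u _; exact: cst_continuous.
split=> [u _|i]; first by split; [exact: cst_continuous|move=> i; exact: derivable_cst].
rewrite (_ : partial i _ = fun=> 0) //.
by apply/funext => u; rewrite /partial derive_cst.
Qed.

Lemma CkD k V f g : open V -> Ck k V f -> Ck k V g -> Ck k V (fun u => f u + g u).
Proof.
move=> Vo; elim: k f g => [|k IH] f g /=.
  by move=> cf cg u Vu; apply: continuousD; [exact: cf|exact: cg].
move=> [cf pf] [cg pg]; split=> [u Vu|i].
  have [cfu dfu] := cf u Vu; have [cgu dgu] := cg u Vu.
  by split; [exact: continuousD|move=> i; exact: derivableD].
apply: Ck_congr (IH _ _ (pf i) (pg i)) => // u Vu.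
have [_ dfu] := cf u Vu; have [_ dgu] := cg u Vu.
by rewrite [RHS]deriveD.
Qed.

Lemma CkM k V f g : open V -> Ck k V f -> Ck k V g -> Ck k V (fun u => f u * g u).
Proof.
move=> Vo; elim: k f g => [|k IH] f g.
  by move=> cf cg u Vu; apply: continuousM; [exact: cf|exact: cg].
move=> Cf Cg; have Cf' := CkW Cf; have Cg' := CkW Cg.
move: Cf Cg => [cf pf] [cg pg]; split=> [u Vu|i].
  have [cfu dfu] := cf u Vu; have [cgu dgu] := cg u Vu.
  by split; [exact: continuousM|move=> i; exact: derivableM].
apply: Ck_congr (CkD Vo (IH _ _ Cf' (pg i)) (IH _ _ Cg' (pf i))) => // u Vu.
have [_ dfu] := cf u Vu; have [_ dgu] := cg u Vu.
by rewrite [RHS]deriveM.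
Qed.

Lemma CkN k V f : open V -> Ck k V f -> Ck k V (fun u => - f u).
Proof.
move=> Vo Cf; apply: Ck_congr (CkM Vo (Ck_cst k V (-1)) Cf) => // u _.
by rewrite mulN1r.
Qed.

Lemma CkB k V f g : open V -> Ck k V f -> Ck k V g -> Ck k V (fun u => f u - g u).
Proof. by move=> Vo Cf Cg; apply: CkD => //; exact: CkN. Qed.

Lemma Ck_sum k V (I : Type) (r : seq I) (P : pred I) (f : I -> 'rV[R]_m -> R) :
  open V -> (forall i, Ck k V (f i)) ->
  Ck k V (fun u => \sum_(i <- r | P i) f i u).
Proof.
move=> Vo Cf; rewrite (_ : (fun u => _) = \sum_(i <- r | P i) f i).
  by elim/big_ind: _ => //; [exact: Ck_cst|move=> *; exact: CkD].
by apply/funext => u; rewrite fct_sumE.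
Qed.

Lemma Ck_prod k V (I : Type) (r : seq I) (P : pred I) (f : I -> 'rV[R]_m -> R) :
  open V -> (forall i, Ck k V (f i)) ->
  Ck k V (fun u => \prod_(i <- r | P i) f i u).
Proof.
move=> Vo Cf; elim: r => [|i r IH].
  by apply: Ck_congr (Ck_cst k V 1) => // u _; rewrite big_nil.
case Pi: (P i); last by apply: Ck_congr IH => // u _; rewrite big_cons Pi.
by apply: Ck_congr (CkM Vo (Cf i) IH) => // u _; rewrite big_cons Pi.
Qed.

(** The derivative of [1 / f] is a polynomial in [1 / f] and the derivatives of
    [f]. *)
Lemma CkV k V f : open V -> (forall u, V u -> f u != 0) ->
  Ck k V f -> Ck k V (fun u => (f u)^-1).
Proof.
move=> Vo f0; elim: k => [|k IH].
  by move=> cf u Vu; exact: cvgV (f0 u Vu) (cf u Vu).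
move=> Cf; have Cf' := IH (CkW Cf); move: Cf => [cf pf].
split=> [u Vu|i].
  have [cfu dfu] := cf u Vu.
  by split; [exact: cvgV (f0 u Vu) cfu|move=> i; apply: derivableV => //; exact: f0].
apply: Ck_congr (CkN Vo (CkM Vo (CkM Vo Cf' Cf') (pf i))) => // u Vu.
have [_ dfu] := cf u Vu.
rewrite /partial deriveV //; last exact: f0.
by rewrite -exprVn expr2 scaleNr.
Qed.

Lemma Ck_det k V n (G : 'rV[R]_m -> 'M[R]_n) : open V ->
  (forall i j, Ck k V (fun u => G u i j)) -> Ck k V (fun u => \det (G u)).
Proof.
move=> Vo CG; apply: Ck_sum => // s; apply: CkM => //; first exact: Ck_cst.
exact: Ck_prod.
Qed.

(** Cramer's rule. *)
Lemma Ck_invmx k V n (G : 'rV[R]_m -> 'M[R]_n) : open V ->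
  (forall u, V u -> G u \in unitmx) ->
  (forall i j, Ck k V (fun u => G u i j)) ->
  forall i j, Ck k V (fun u => invmx (G u) i j).
Proof.
move=> Vo GU CG i j.
apply: (@Ck_congr _ _ (fun u => (\det (G u))^-1 * cofactor (G u) j i)) => //.
  by move=> u Vu; rewrite /invmx GU // !mxE.
apply: CkM => //.
  apply: CkV => //; last exact: Ck_det.
  by move=> u /GU; rewrite unitmxE unitfE.
apply: CkM => //; first exact: Ck_cst.
by apply: Ck_det => // a b; under eq_fun do rewrite !mxE; exact: CG.
Qed.

End CkFunctions.

(** * Second derivatives *)

Section SecondOrder.
Variables (R : realType) (m : nat).
Implicit Types (f g : 'rV[R]_m -> R) (V : set 'rV[R]_m).

Lemma open_ball_sub V x : open V -> V x ->
  exists2 d : R, 0 < d & forall y, `|y - x| < d -> V y.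
Proof.
move=> Vo Vx; have /nbhs_ballP[d /= d0 dV] : nbhs x V by exact: open_nbhs_nbhs.
by exists d => // y yx; apply: dV; rewrite -ball_normE /= distrC.
Qed.

Lemma norm_delta_le (i : 'I_m) (a : R) : `|a *: delta_mx 0 i : 'rV[R]_m| <= `|a|.
Proof.
apply: rVnorm_le => // j; rewrite !mxE eqxx /=.
by case: eqP => _; rewrite ?mulr1 ?mulr0 ?normr0.
Qed.

Lemma is_derive_translate (W : normedModType R) (f : 'rV[R]_m -> W) w x v :
  derivable f (x + w) v ->
  is_derive x v (fun y => f (y + w)) ('D_v f (x + w)).
Proof.
have gE : (fun h : R => h^-1 *: (((fun y => f (y + w)) \o shift x) (h *: v)
             - f (x + w)))
        = (fun h : R => h^-1 *: ((f \o shift (x + w)) (h *: v) - f (x + w))).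
  by apply/funext => h /=; rewrite addrA.
by move=> df; split; rewrite /derivable /derive gE.
Qed.

(** Two applications of the mean value theorem, along [e_i] to the increment in
    the direction [e_j], then along [e_j].  The left-hand side is symmetric in
    [i] and [j], which is the source of the symmetry of second derivatives. *)
Lemma second_difference V f x (d h : R) i j :
  Ck 2 V f -> (forall y, `|y - x| < d -> V y) -> 0 < h -> h + h < d ->
  exists2 y, `|y - x| < d &
  f (x + h *: delta_mx 0 i + h *: delta_mx 0 j) - f (x + h *: delta_mx 0 i)
   - (f (x + h *: delta_mx 0 j) - f x) = h * (h * partial j (partial i f) y).
Proof.
move=> Cf dV h0 hd.
set a := h *: delta_mx 0 i; set b := h *: delta_mx 0 j.
have ah : `|a| <= h by rewrite -[leRHS](gtr0_norm h0) norm_delta_le.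
have bh : `|b| <= h by rewrite -[leRHS](gtr0_norm h0) norm_delta_le.
have in_ball (t s : R) : 0 <= t <= 1 -> 0 <= s <= 1 -> `|x + t *: a + s *: b - x| < d.
  move=> /andP[t0 t1] /andP[s0 s1]; apply: le_lt_trans hd.
  rewrite addrAC [x + _ - x]addrAC subrr add0r.
  apply: le_trans (ler_normD _ _) _.
  rewrite [`|t *: a|]normrZ [`|s *: b|]normrZ !ger0_norm //.
  by rewrite lerD //; [apply: le_trans ah|apply: le_trans bh]; rewrite ler_piMl.
have I0 : 0 <= (0 : R) <= 1 by rewrite lexx ler01.
have I1 : 0 <= (1 : R) <= 1 by rewrite lexx ler01.
pose g y := f (y + b) - f y.
have df y k : `|y - x| < d -> derivable f y (delta_mx 0 k).
  by move=> /dV; apply: Ck_derivable Cf.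
have dg (t : R) : 0 <= t <= 1 ->
    is_derive (x + t *: a) a g
      (h * (partial i f (x + t *: a + b) - partial i f (x + t *: a))).
  move=> t01; have -> : h * (partial i f (x + t *: a + b) - partial i f (x + t *: a))
     = h *: partial i f (x + t *: a + b) - h *: partial i f (x + t *: a).
    by rewrite -scalerBr.
  have d1 : derivable f (x + t *: a + b) (delta_mx 0 i).
    by apply: df; rewrite -[X in _ + X - _]scale1r; apply: in_ball.
  have d2 : derivable f (x + t *: a) (delta_mx 0 i).
    apply: df; have := in_ball t 0 t01 I0.
    by rewrite scale0r addr0.
  have D1 := is_derive_dirZ h d1.
  have [D1a D1b] := D1.
  have D2 := is_derive_dirZ h d2.
  apply: is_deriveB; rewrite -D1b.
  exact: is_derive_translate.
have [t t01|t /andP[t0 t1]] := @MVT_line R _ g x a; first by have [] := dg t t01.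
have t01 : 0 <= t <= 1 by rewrite !ltW.
rewrite (@derive_val _ _ _ _ _ _ _ (dg t t01)) /g => ->.
have dpf (s : R) : 0 <= s <= 1 ->
    derivable (partial i f) (x + t *: a + s *: b) (delta_mx 0 j).
  move=> s01; apply: Ck_derivable (Ck_partial i Cf) _.
  by apply: dV; exact: in_ball.
have [s s01|s /andP[s0 s1]] := @MVT_line R _ (partial i f) (x + t *: a) b.
  by have [] := is_derive_dirZ h (dpf s s01).
have s01 : 0 <= s <= 1 by rewrite !ltW.
rewrite (@derive_val _ _ _ _ _ _ _ (is_derive_dirZ h (dpf s s01))) => ->.
by exists (x + t *: a + s *: b) => //; exact: in_ball.
Qed.

(** Divided by [h ^+ 2], the second difference is close to both mixed derivatives
    at [x]. *)
Lemma partialC V f x i j : open V -> Ck 2 V f -> V x ->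
  partial i (partial j f) x = partial j (partial i f) x.
Proof.
move=> Vo Cf Vx; have [d0 d00 dV] := open_ball_sub Vo Vx.
apply/eqP; rewrite -subr_eq0 -normr_le0; apply/ler_addgt0Pr => e e0; rewrite add0r.
have e2 : 0 < e / 2 by rewrite divr_gt0.
have c1 : {for x, continuous (partial i (partial j f))}.
  exact: Ck_cont (Ck_partial i (Ck_partial j Cf)) Vx.
have c2 : {for x, continuous (partial j (partial i f))}.
  exact: Ck_cont (Ck_partial j (Ck_partial i Cf)) Vx.
have /cvgrPdist_le /(_ _ e2) /nbhs_ballP[d1 /= d10 d1P] := c1.
have /cvgrPdist_le /(_ _ e2) /nbhs_ballP[d2 /= d20 d2P] := c2.
pose d := Num.min d0 (Num.min d1 d2).
have d_gt0 : 0 < d by rewrite /d !lt_min d00 d10 d20.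
pose h := d / 3.
have h0 : 0 < h by rewrite /h divr_gt0.
have hd : h + h < d by rewrite /h; lra.
have dV' y : `|y - x| < d -> V y.
  by move=> yd; apply: dV; apply: lt_le_trans yd _; rewrite /d ge_min lexx.
have [y yd yE] := second_difference i j Cf dV' h0 hd.
have [z zd zE] := second_difference j i Cf dV' h0 hd.
have yz : partial j (partial i f) y = partial i (partial j f) z.
  have E : h * (h * partial j (partial i f) y) = h * (h * partial i (partial j f) z).
    have xE := addrAC x (h *: delta_mx 0 j) (h *: delta_mx 0 i).
    apply: etrans (esym yE) _; apply: etrans _ zE; rewrite xE.
    set A := f _; set B := f (x + _); set C := f (x + _); set D := f x.
    by clearbody A B C D; ring.
  have h0' : h != 0 by rewrite gt_eqF.
  exact: (mulfI h0' (mulfI h0' E)).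
have zd1 : ball x d1 z.
  rewrite -ball_normE /= distrC; apply: lt_le_trans zd _.
  by rewrite /d !ge_min lexx !orbT.
have yd2 : ball x d2 y.
  rewrite -ball_normE /= distrC; apply: lt_le_trans yd _.
  by rewrite /d !ge_min lexx !orbT.
have /= H1 := d1P z zd1; have /= H2 := d2P y yd2; rewrite yz in H2.
set A := partial i (partial j f) x in H1 *.
set B := partial j (partial i f) x in H2 *.
set Q := partial i (partial j f) z in H1 H2.
clearbody A B Q.
have -> : A - B = (A - Q) - (B - Q) by ring.
apply: le_trans (ler_normB _ _) _; rewrite [leRHS]splitr.
exact: lerD H1 H2.
Qed.

Lemma partial_local_max V f x i : open V -> Ck 1 V f -> V x ->
  (forall y, V y -> f y <= f x) -> partial i f x = 0.
Proof.
move=> Vo Cf Vx fx; have [d d0 dV] := open_ball_sub Vo Vx.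
have dV' (t : R) : t \in `](- d), d[ -> V (x + t *: delta_mx 0 i).
  rewrite in_itv /= => td; apply: dV; rewrite addrAC subrr add0r.
  by apply: le_lt_trans (norm_delta_le _ _) _; rewrite ltr_norml.
have D0 : derivable f x (delta_mx 0 i) by apply: Ck_derivable Cf Vx.
have : is_derive (0 : R) 1 (fun t => f (x + t *: delta_mx 0 i)) 0.
  apply: (@derive1_at_max _ _ (- d) d).
  - by rewrite ge0_cp // ltW.
  - move=> t td; have [] // := @is_derive_line R _ _ f x (delta_mx 0 i) t.
    by apply: Ck_derivable Cf _; exact: dV'.
  - by rewrite in_itv /= oppr_lt0 d0.
  - by move=> t td; rewrite scale0r addr0; apply: fx; exact: dV'.
move=> D; have := derivable_line D0 => D'.
by rewrite /partial -(@derive_val _ _ _ _ _ _ _ D') (@derive_val _ _ _ _ _ _ _ D).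
Qed.

Lemma Ck_is_derive k V f u v : open V -> Ck k.+1 V f -> V u ->
  is_derive u v f (grad_form f u v).
Proof.
move=> Vo Cf Vu; have Df := Ck_is_diff Vo Cf Vu.
have dfu : differentiable f u by apply: ex_diff.
split; first exact: diff_derivable.
by rewrite deriveE // (@diff_val _ _ _ _ _ _ _ Df).
Qed.

(** If the second derivative along [v] were positive then the first one, which
    vanishes at [x], would be positive just after [x], and [f] would exceed its
    maximum there. *)
Lemma hessian_local_max V f x (v : 'rV[R]_m) : open V -> Ck 2 V f -> V x ->
  (forall y, V y -> f y <= f x) ->
  \sum_i \sum_j v 0 i * v 0 j * partial i (partial j f) x <= 0.
Proof.
move=> Vo Cf Vx fx; have [d d0 dV] := open_ball_sub Vo Vx.
set c := (X in X <= 0); rewrite leNgt; apply/negP => c0.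
(* The derivative of [f] along [v]; its own derivative along [v] is [c]. *)
pose psi y := grad_form f y v.
have Cpsi : Ck 1 V psi.
  apply: Ck_sum => // i; apply: CkM => //; first exact: Ck_cst.
  exact: Ck_partial.
have psi0 : psi x = 0.
  rewrite /psi /grad_form big1 // => i _.
  by rewrite (partial_local_max _ Vo (CkW Cf)) // mulr0.
have psic : 'D_v psi x = c.
  rewrite (@derive_val _ _ _ _ _ _ _ (Ck_is_derive v Vo Cpsi Vx)) /grad_form.
  apply: eq_bigr => i _.
  rewrite /psi /grad_form /partial.
  rewrite (_ : (fun y => _) = \sum_j ((fun y => v 0 j * partial j f y))); last first.
    by apply/funext => y; rewrite fct_sumE.
  have dj j : derivable (partial j f) x (delta_mx 0 i).
    exact: Ck_derivable (Ck_partial j Cf) Vx.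
  rewrite derive_sum; last by move=> j; apply: derivableM => //; exact: derivable_cst.
  rewrite mulr_sumr; apply: eq_bigr => j _.
  by rewrite -mulrA deriveMl.
have dpsi : derivable psi x v.
  by have [] := Ck_is_derive v Vo Cpsi Vx.
have /cvgrPdist_lt :
    (fun h : R => h^-1 *: ((psi \o shift x) (h *: v) - psi x)) @ 0^' --> c.
  by rewrite -psic.
move=> /(_ _ c0) [e /= e0 eP].
have psi_gt0 (t : R) : 0 < t -> t < e -> 0 < psi (x + t *: v).
  move=> t0 te; rewrite [x + _]addrC; have := eP t.
  rewrite /ball /= sub0r normrN gtr0_norm // => /(_ te).
  rewrite gt_eqF // => /(_ isT); rewrite psi0 subr0.
  move=> /(le_lt_trans (ler_norm _)); rewrite ltrBlDr ltrDl.
  by rewrite [_ *: _]/(_ * _) pmulr_rgt0 // invr_gt0.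
pose t := Num.min (e / 2) (d / (2 * (`|v| + 1))).
have v1 : 0 < `|v| + 1 by rewrite ltr_pwDr.
have t0 : 0 < t by rewrite /t lt_min !divr_gt0 // mulr_gt0.
have te : t < e.
  by rewrite /t gt_min; apply/orP; left; lra.
have tv (s : R) : 0 <= s <= 1 -> V (x + s *: (t *: v)).
  move=> /andP[s0 s1]; apply: dV; rewrite addrAC subrr add0r !normrZ.
  rewrite ger0_norm // gtr0_norm //.
  apply: (@le_lt_trans _ _ (t * `|v|)).
    by rewrite ler_piMl // mulr_ge0 // ltW.
  apply: (@le_lt_trans _ _ (d / (2 * (`|v| + 1)) * `|v|)).
    by rewrite ler_wpM2r // /t ge_min lexx orbT.
  rewrite mulrAC ltr_pdivrMr ?mulr_gt0 // ltr_pM2l //.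
  have : 0 <= `|v| by [].
  by move=> ?; lra.
have Df (s : R) : 0 <= s <= 1 -> is_derive (x + s *: (t *: v)) (t *: v) f
    (t * psi (x + s *: (t *: v))).
  move=> s01; have D := Ck_is_derive v Vo Cf (tv s s01).
  have [D1 D2] := D.
  by rewrite /psi -D2; apply: is_derive_dirZ.
have [s s01|s /andP[s0 s1]] := @MVT_line R _ f x (t *: v).
  by have [] := Df s s01.
have s01 : 0 <= s <= 1 by rewrite !ltW.
rewrite (@derive_val _ _ _ _ _ _ _ (Df s s01)) scalerA => fE.
have : f (x + t *: v) - f x <= 0.
  by rewrite subr_le0; apply: fx; have := tv 1; rewrite scale1r lexx ler01; apply.
rewrite fE pmulr_rle0 // leNgt psi_gt0 // ?mulr_gt0 //.
by apply: lt_trans te; rewrite gtr_pMl.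
Qed.

End SecondOrder.

(** * Rules for partial derivatives and the squared distance *)

Section PartialRules.
Variables (R : realType) (m : nat).
Implicit Types (f g : 'rV[R]_m -> R) (V : set 'rV[R]_m) (i : 'I_m).

Lemma partial_cst (W : normedModType R) i (c : W) (u : 'rV[R]_m) :
  partial i (fun=> c) u = 0.
Proof. by rewrite /partial derive_cst. Qed.

Lemma partialD k V f g i u : Ck k.+1 V f -> Ck k.+1 V g -> V u ->
  partial i (fun y => f y + g y) u = partial i f u + partial i g u.
Proof.
move=> Cf Cg Vu.
by rewrite [LHS]deriveD //; [exact: Ck_derivable Cf Vu|exact: Ck_derivable Cg Vu].
Qed.

Lemma partialB k V f g i u : Ck k.+1 V f -> Ck k.+1 V g -> V u ->
  partial i (fun y => f y - g y) u = partial i f u - partial i g u.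
Proof.
move=> Cf Cg Vu.
by rewrite [LHS]deriveB //; [exact: Ck_derivable Cf Vu|exact: Ck_derivable Cg Vu].
Qed.

Lemma partialN k V f i u : Ck k.+1 V f -> V u ->
  partial i (fun y => - f y) u = - partial i f u.
Proof. by move=> Cf Vu; rewrite [LHS]deriveN //; exact: Ck_derivable Cf Vu. Qed.

Lemma partialM k V f g i u : Ck k.+1 V f -> Ck k.+1 V g -> V u ->
  partial i (fun y => f y * g y) u = partial i f u * g u + f u * partial i g u.
Proof.
move=> Cf Cg Vu.
rewrite [LHS]deriveM //; [|exact: Ck_derivable Cf Vu|exact: Ck_derivable Cg Vu].
by rewrite addrC mulrC.
Qed.

Lemma partial_sum k V (J : finType) (f : J -> 'rV[R]_m -> R) i u :
  (forall j, Ck k.+1 V (f j)) -> V u ->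
  partial i (fun y => \sum_j f j y) u = \sum_j partial i (f j) u.
Proof.
move=> Cf Vu; pose F (s : seq J) := fun y => \sum_(j <- s) f j y.
suff [_] : derivable (F (index_enum J)) u (delta_mx 0 i) /\
  partial i (F (index_enum J)) u = \sum_j partial i (f j) u by [].
elim: (index_enum J) => [|j s [IHd IH]].
  have -> : F [::] = fun=> 0 by apply/funext => y; rewrite /F big_nil.
  by rewrite big_nil partial_cst; split => //; exact: derivable_cst.
have -> : F (j :: s) = f j + F s by apply/funext => y; rewrite /F big_cons.
have dj := Ck_derivable (i := i) (Cf j) Vu.
by split; [exact: derivableD|rewrite [LHS]deriveD // big_cons -IH].
Qed.

Lemma partial_coord i j (u : 'rV[R]_m) :
  partial i (fun y => y 0 j) u = (i == j)%:R.
Proof.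
have d1 : derivable (@id 'rV[R]_m) u (delta_mx 0 i) by exact: derivable_id.
have := derive_mx d1; rewrite derive_id => /matrixP /(_ 0 j).
by rewrite !mxE eqxx /= eq_sym => E; exact: esym E.
Qed.

Lemma Ck_coord k V j : Ck k V (fun y => y 0 j).
Proof.
case: k => [|k]; first by move=> u _; exact: coord_continuous.
split=> [u _|i].
  split=> [|i]; first exact: coord_continuous.
  by have /derivable_mxP := @derivable_id _ _ u (delta_mx 0 i); apply.
have -> : partial i (fun y : 'rV[R]_m => y 0 j) = fun=> (i == j)%:R.
  by apply/funext => u; exact: partial_coord.
exact: Ck_cst.
Qed.

(** The sup norm has balls with corners; the argument with a touching ball needs
    the smooth Euclidean distance. *)
Definition sqdist (c y : 'rV[R]_m) : R := \sum_i (y 0 i - c 0 i) * (y 0 i - c 0 i).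

Lemma Ck_sqdist k V c : open V -> Ck k V (sqdist c).
Proof.
by move=> Vo; apply: Ck_sum => // i; apply: CkM => //;
   apply: CkB => //; [exact: Ck_coord|exact: Ck_cst|exact: Ck_coord|exact: Ck_cst].
Qed.

Lemma partial_coordB i j (a : R) (u : 'rV[R]_m) :
  partial i (fun y => y 0 j - a) u = (i == j)%:R.
Proof.
rewrite (@partialB 0 setT) //; [|exact: Ck_coord|exact: Ck_cst].
by rewrite partial_cst subr0 partial_coord.
Qed.

Lemma partial_sqdist c i : partial i (sqdist c) = fun u => 2 * (u 0 i - c 0 i).
Proof.
apply/funext => u.
have CB j : Ck 1 setT (fun y : 'rV[R]_m => y 0 j - c 0 j).
  by apply: CkB; [exact: openT|exact: Ck_coord|exact: Ck_cst].
rewrite (@partial_sum 0 setT) // => [|j]; last by apply: CkM => //; exact: openT.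
rewrite (bigD1 i) //= big1 => [|j ji]; rewrite (@partialM 0 setT) // !partial_coordB.
  by rewrite eqxx addr0 mul1r mulr1 -mulr2n mulr_natl.
by rewrite eq_sym (negbTE ji) mul0r mulr0 addr0.
Qed.

Lemma sqdist_ge0 c y : 0 <= sqdist c y.
Proof. by apply: sumr_ge0 => i _; rewrite -expr2 sqr_ge0. Qed.

Lemma sqdistxx y : sqdist y y = 0.
Proof. by rewrite /sqdist big1 // => i _; rewrite subrr mul0r. Qed.

Lemma sqdist_eq0 c y : sqdist c y = 0 -> y = c.
Proof.
move=> s0; apply/rowP => i.
have := s0; move=> /eqP; rewrite psumr_eq0 => [|j _]; last by rewrite -expr2 sqr_ge0.
move=> /allP /(_ i (mem_index_enum _)) /=.
by rewrite mulf_eq0 orbb subr_eq0 => /eqP.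
Qed.

Lemma sqdist_coord (c y : 'rV[R]_m) i : (y 0 i - c 0 i) ^+ 2 <= sqdist c y.
Proof.
rewrite /sqdist (bigD1 i) //= -expr2 lerDl; apply: sumr_ge0 => j _.
by rewrite -expr2 sqr_ge0.
Qed.

Lemma sqdist_le (c y : 'rV[R]_m) : sqdist c y <= m%:R * `|y - c| ^+ 2.
Proof.
rewrite mulr_natl -[X in _ *+ X]card_ord -sumr_const; apply: ler_sum => i _.
rewrite -expr2 -real_normK ?num_real //.
by rewrite lerXn2r ?nnegrE //; have := le_rVnorm (y - c) i; rewrite !mxE.
Qed.

End PartialRules.

(** * Maxima on closed bounded sets *)

Section Compactness.
Variables (R : realType) (m : nat).

Lemma cball_compact (x : 'rV[R]_m) (d : R) : compact (closed_ball_ Num.norm x d).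
Proof.
apply: bounded_closed_compact; last exact: closed_closed_ball_.
exists (`|x| + d); split; first exact: num_real.
move=> M xM y /= xy; apply: le_trans (ltW xM).
rewrite -[y](subrK x) addrC (le_trans (ler_normD _ _)) // lerD2l //.
by rewrite distrC.
Qed.

Lemma closedI_preimage (T : topologicalType) (A : set T) (f : T -> R) (D : set R) :
  closed A -> closed D -> (forall x, A x -> {for x, continuous f}) ->
  closed (A `&` f @^-1` D).
Proof.
move=> cA cD cf p clp.
have Ap : A p by apply: cA => B /clp[q [[Aq _] Bq]]; exists q.
split=> //; apply: cD => B /(cf p Ap) /clp[q [[_ Dq] Bq]].
by exists (f q).
Qed.

Lemma EVT_max_closed (A : set 'rV[R]_m) (x : 'rV[R]_m) (d : R) (f : 'rV[R]_m -> R) :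
  closed A -> A `<=` closed_ball_ Num.norm x d -> A !=set0 ->
  (forall y, A y -> {for y, continuous f}) ->
  exists2 c, A c & forall y, A y -> f y <= f c.
Proof.
move=> cA AB A0 cf; have cpA := subclosed_compact cA (@cball_compact x d) AB.
have [c Ac cmax] : exists2 c, c \in A & forall t, t \in A -> f t <= f c.
  apply: EVT_max_rV => //; apply: continuous_in_subspaceT => y /set_mem.
  exact: cf.
by exists c => [|y Ay]; [exact: set_mem|apply: cmax; exact: mem_set].
Qed.

End Compactness.

(** * The strong maximum principle *)

(* Otherwise a failing comparison of two iterated derivatives unfolds them
   down to limits of difference quotients. *)
Opaque Ck derive.

Section MaxPrinciple.
Variables (R : realType) (m : nat).
Implicit Types (V : set 'rV[R]_m) (a : 'rV[R]_m -> 'M[R]_m).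
Implicit Types (b : 'rV[R]_m -> 'I_m -> R) (f u : 'rV[R]_m -> R).

Definition elliptic_op a b f (x : 'rV[R]_m) : R :=
  \sum_i \sum_j a x i j * partial i (partial j f) x
  + \sum_k b x k * partial k f x.

(** The gradient vanishes, and the factorization [a = Q Q^T] turns the second
    order part into a sum of second derivatives along the columns of [Q]. *)
Lemma elliptic_op_local_max (p : nat) (Q : 'M[R]_(m, p)) V a b f x :
  open V -> Ck 2 V f -> V x -> (forall y, V y -> f y <= f x) ->
  a x = Q *m Q^T -> elliptic_op a b f x <= 0.
Proof.
move=> Vo Cf Vx fx aQ; rewrite /elliptic_op [X in _ + X]big1 ?addr0; last first.
  by move=> k _; rewrite (partial_local_max _ Vo (CkW Cf)) // mulr0.
have -> : \sum_i \sum_j a x i j * partial i (partial j f) x =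
  \sum_k \sum_i \sum_j (col k Q)^T 0 i * (col k Q)^T 0 j * partial i (partial j f) x.
  rewrite [RHS]exchange_big /=; apply: eq_bigr => i _.
  rewrite [RHS]exchange_big /=; apply: eq_bigr => j _.
  rewrite -mulr_suml aQ mxE; congr (_ * _); apply: eq_bigr => k _.
  by rewrite !mxE.
by apply: sumr_le0 => k _; apply: hessian_local_max Vo Cf Vx fx.
Qed.

(** Near [x] the set where [u] is maximal lies in the region [psi < 0], with [x] on
    its boundary.  Then [psi] cannot be a strict subsolution: for small [e] the
    function [u + e psi] would be smaller on the sphere of radius [d] than at the
    centre [x], hence have an interior maximum, where the operator is
    nonpositive. *)
Lemma no_touching V a b (p : nat) (Q : 'rV[R]_m -> 'M[R]_(m, p)) u psi x (d : R) :
  open V -> Ck 2 V u -> Ck 2 V psi ->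
  (forall y, V y -> a y = Q y *m (Q y)^T) ->
  (forall y, V y -> 0 <= elliptic_op a b u y) ->
  (forall y, V y -> 0 < elliptic_op a b psi y) ->
  0 < d -> closed_ball_ Num.norm x d `<=` V ->
  (forall y, V y -> u y <= u x) -> psi x = 0 ->
  (forall y, V y -> y != x -> 0 <= psi y -> u y < u x) -> False.
Proof.
move=> Vo Cu Cpsi aQ Lu Lpsi d0 BV umax psi0 touch.
pose B := closed_ball_ Num.norm x d.
have Bcl : closed B by exact: closed_closed_ball_.
pose K := (B `&` (fun y => `|x - y|) @^-1` [set r | d <= r])
  `&` psi @^-1` [set r | 0 <= r].
have cnorm (y : 'rV[R]_m) : {for y, continuous (fun y : 'rV[R]_m => `|x - y|)}.
  apply: (continuous_comp _ (@norm_continuous _ _ _)).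
  exact: (continuousB (@cst_continuous _ _ _ _)).
have Kcl : closed K.
  apply: closedI_preimage; [|exact: closed_ge|]; last first.
    by move=> y [By _]; apply: Ck_cont Cpsi (BV _ By).
  by apply: closedI_preimage => //; exact: closed_ge.
have KV y : K y -> V y by move=> [[By _] _]; exact: BV.
have [e e0 eK] : exists2 e, 0 < e & forall y, K y -> u y + e * psi y < u x.
  have [K0|/set0P/negP/negPn/eqP K0] := pselect (K !=set0); last first.
    by exists 1 => // y; rewrite K0.
  have KB : K `<=` B by move=> y [[]].
  have [c1 Kc1 c1P] := EVT_max_closed Kcl KB K0 (fun y Ky => Ck_cont Cu (KV y Ky)).
  have [c2 Kc2 c2P] := EVT_max_closed Kcl KB K0 (fun y Ky => Ck_cont Cpsi (KV y Ky)).
  have uc1 : u c1 < u x.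
    case: (Kc1) => [[Bc1 /= dc1] pc1]; apply: touch => //; first exact: KV.
    by apply: contraTneq dc1 => ->; rewrite subrr normr0 -ltNge.
  have psi2 : 0 <= psi c2 by case: Kc2.
  exists ((u x - u c1) / (psi c2 + 1)).
    by rewrite divr_gt0 ?subr_gt0 // ltr_pwDr.
  move=> y Ky; rewrite -ltrBrDl.
  apply: (@lt_le_trans _ _ (u x - u c1)); last by rewrite lerB // c1P.
  rewrite mulrAC ltr_pdivrMr ?ltr_pwDr // ltr_pM2l ?subr_gt0 //.
  by rewrite ltr_pwDr // c2P.
pose v y := u y + e * psi y.
have Cv : Ck 2 V v by exact: CkD Vo Cu (CkM Vo (Ck_cst 2 V e) Cpsi).
have Bx : B x by rewrite /B /closed_ball_ /= subrr normr0 ltW.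
have [z Bz zP] : exists2 z, B z & forall y, B y -> v y <= v z.
  apply: (@EVT_max_closed _ _ B x d) => //; first by exists x.
  by move=> y By; apply: Ck_cont Cv (BV _ By).
have vx : v x = u x by rewrite /v psi0 mulr0 addr0.
have Bz_int : `|z - x| < d.
  rewrite distrC ltNge; apply/negP => dz.
  have : v z < u x.
    have [pz|pz] := leP 0 (psi z); first by apply: eK.
    rewrite /v (@lt_le_trans _ _ (u z)) //; last by apply/umax/BV.
    by rewrite gtrDl pmulr_rlt0.
  by rewrite -vx ltNge zP.
pose U := [set y | `|y - x| < d].
have UE : U = ball x d by apply/seteqP; split=> y; rewrite -ball_normE /U /= distrC.
have Uo : open U by rewrite UE; exact: ball_open.
have UB : U `<=` B by move=> y /= /ltW; rewrite /B /closed_ball_ /= distrC.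
have CvU : Ck 2 U v by apply: Ck_sub Cv => y /UB /BV.
have := elliptic_op_local_max b Uo CvU Bz_int (fun y Uy => zP y (UB y Uy)) (aQ z (BV z Bz)).
apply/negP; rewrite -ltNge.
have Vz := BV z Bz.
have Cep := CkM Vo (Ck_cst 2 V e) Cpsi.
have p1 w k : V w -> partial k v w = partial k u w + e * partial k psi w.
  move=> Vw; rewrite (partialD _ Cu Cep Vw) (partialM _ (Ck_cst 2 V e) Cpsi Vw).
  by rewrite partial_cst mul0r add0r.
have p2 i j : partial i (partial j v) z =
    partial i (partial j u) z + e * partial i (partial j psi) z.
  rewrite (partial_congr i Vo (fun w Vw => p1 w j Vw) Vz).
  have Cj := Ck_partial j Cu; have Cpj := Ck_partial j Cpsi.
  rewrite (partialD _ Cj (CkM Vo (Ck_cst 1 V e) Cpj) Vz).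
  rewrite (partialM _ (Ck_cst 1 V e) Cpj Vz).
  by rewrite partial_cst mul0r add0r.
have -> : elliptic_op a b v z = elliptic_op a b u z + e * elliptic_op a b psi z.
  rewrite /elliptic_op mulrDr addrACA; congr (_ + _).
    rewrite mulr_sumr -big_split; apply: eq_bigr => i _ /=.
    rewrite mulr_sumr -big_split; apply: eq_bigr => j _ /=.
    by rewrite p2 mulrDr mulrCA.
  rewrite mulr_sumr -big_split; apply: eq_bigr => k _ /=.
  by rewrite p1 // mulrDr mulrCA.
by rewrite ltr_pwDr ?Lu // mulr_gt0 // Lpsi.
Qed.


(** Hopf's barrier, with a square in place of the usual exponential.  Near the
    sphere around [q] through [x1] it is a convex function of the squared
    distance [s] to [q] whose ratio of second to first derivative is
    [- 1 / kappa], so that the second order term dominates for small [kappa].  The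
    last term makes the contact at [x1] strict. *)
Definition barrier (kappa : R) (q x1 y : 'rV[R]_m) : R :=
  (kappa + sqdist q x1 - sqdist q y) * (kappa + sqdist q x1 - sqdist q y)
  - kappa * kappa - kappa * sqdist x1 y.

Lemma Ck_barrier k V kappa q x1 : open V -> Ck k V (barrier kappa q x1).
Proof.
move=> Vo.
have Cs c : Ck k V (sqdist c) by exact: Ck_sqdist.
have Cc (c : R) : Ck k V (fun=> c) by exact: Ck_cst.
have CA : Ck k V (fun y => kappa + sqdist q x1 - sqdist q y) by exact: CkB.
by apply: CkB => //; [apply: CkB => //; apply: CkM|apply: CkM].
Qed.

Lemma partial_barrier kappa q x1 j :
  partial j (barrier kappa q x1) = fun y =>
    - (4 * (kappa + sqdist q x1 - sqdist q y) * (y 0 j - q 0 j))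
    - 2 * kappa * (y 0 j - x1 0 j).
Proof.
apply/funext => y.
have oT := @openT 'rV[R]_m.
have Cs c : Ck 1 setT (sqdist c) := Ck_sqdist 1 c oT.
have Cc (c : R) : Ck 1 (@setT 'rV[R]_m) (fun=> c) by exact: Ck_cst.
have CA := CkB oT (Cc (kappa + sqdist q x1)) (Cs q).
have CAA := CkM oT CA CA.
have CB := CkB oT CAA (Cc (kappa * kappa)).
have Cks := CkM oT (Cc kappa) (Cs x1).
rewrite (partialB j CB Cks) // (partialB j CAA (Cc _)) // (partialM j CA CA) //.
rewrite (partialB j (Cc _) (Cs q)) // (partialM j (Cc kappa) (Cs x1)) //.
by rewrite !partial_cst !partial_sqdist; ring.
Qed.

Lemma partial2_barrier kappa q x1 i j :
  partial i (partial j (barrier kappa q x1)) x1 =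
  8 * ((x1 0 i - q 0 i) * (x1 0 j - q 0 j)) - 6 * kappa * (i == j)%:R.
Proof.
rewrite partial_barrier.
have oT := @openT 'rV[R]_m.
have Cs c : Ck 1 setT (sqdist c) := Ck_sqdist 1 c oT.
have Cc (c : R) : Ck 1 (@setT 'rV[R]_m) (fun=> c) by exact: Ck_cst.
have CA := CkB oT (Cc (kappa + sqdist q x1)) (Cs q).
have CB c : Ck 1 setT (fun y : 'rV[R]_m => y 0 j - c).
  by exact: CkB oT (Ck_coord 1 _ j) (Cc c).
have C4A := CkM oT (Cc 4) CA.
have C4AB := CkM oT C4A (CB (q 0 j)).
have CN := CkN oT C4AB.
have C2 := CkM oT (Cc (2 * kappa)) (CB (x1 0 j)).
rewrite (partialB i CN C2) //.
rewrite (partialN i C4AB) //.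
rewrite (partialM i C4A (CB _)) // (partialM i (Cc 4) CA) //.
rewrite (partialB i (Cc _) (Cs q)) // (partialM i (Cc _) (CB _)) //.
rewrite !partial_cst !partial_sqdist !partial_coordB; ring.
Qed.

Lemma Ck_elliptic_op V a b f : open V -> Ck 2 V f ->
  (forall i j, Ck 0 V (fun y => a y i j)) -> (forall k, Ck 0 V (fun y => b y k)) ->
  Ck 0 V (elliptic_op a b f).
Proof.
move=> Vo Cf Ca Cb; apply: CkD => //.
  apply: Ck_sum => // i; apply: Ck_sum => // j; apply: CkM => //.
  exact: Ck_partial (Ck_partial j Cf).
apply: Ck_sum => // k; apply: CkM => //.
exact: CkW (Ck_partial k Cf).
Qed.

(** Were [u] not locally constant at [x0], some [q] close to [x0] would have
    [u q < u x0].  The Euclidean ball around [q] that reaches up to the closest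
    maximum point [x1] contains no maximum point inside, and its barrier is
    excluded by [no_touching]. *)
Lemma strong_max V a b (p : nat) (Q : 'rV[R]_m -> 'M[R]_(m, p)) u x0 :
  open V -> Ck 2 V u ->
  (forall i j, Ck 0 V (fun y => a y i j)) -> (forall k, Ck 0 V (fun y => b y k)) ->
  (forall y, V y -> a y = Q y *m (Q y)^T) ->
  (forall y (z : 'rV[R]_m), V y -> z != 0 ->
     0 < \sum_i \sum_j a y i j * (z 0 i * z 0 j)) ->
  (forall y, V y -> 0 <= elliptic_op a b u y) ->
  V x0 -> (forall y, V y -> u y <= u x0) ->
  \forall y \near x0, u y = u x0.
Proof.
move=> Vo Cu Ca Cb aQ ell Lu Vx0 umax.
have [d0 d00 dV] := open_ball_sub Vo Vx0.
(* The Euclidean norm is at most [m.+1] times the sup norm, so for [q] within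
   [e] of [x0] the maximum point closest to [q] is within [d0 / 2] of [x0]. *)
pose e := d0 / 2 / m.+2%:R.
have e0 : 0 < e by rewrite !divr_gt0.
apply/nbhs_ballP; exists e => //= q; rewrite -ball_normE /= => qe.
apply: contrapT => /eqP uq.
have e_d0 : e < d0.
  rewrite /e ltr_pdivrMr // ltr_pdivrMr // -mulrA ltr_pMr //.
  by rewrite -natrM ltr1n.
have Vq : V q by apply: dV; rewrite distrC; exact: lt_trans qe e_d0.
pose B := closed_ball_ Num.norm x0 (d0 / 2).
have BV : B `<=` V.
  move=> y /=; rewrite /B /closed_ball_ /= distrC => yB; apply: dV.
  by apply: le_lt_trans yB _; rewrite ltr_pdivrMr // ltr_pMr // ltr1n.
pose C := B `&` u @^-1` [set u x0].
have Ccl : closed C.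
  apply: closedI_preimage; [exact: closed_closed_ball_|exact: closed_eq|].
  by move=> y /BV; exact: Ck_cont Cu.
have Cx0 : C x0 by split=> //; rewrite /B /closed_ball_ /= subrr normr0 divr_ge0 // ltW.
have [x1 [Bx1 /= ux1] x1P] : exists2 c, C c & forall y, C y -> - sqdist q y <= - sqdist q c.
  apply: (@EVT_max_closed _ _ C x0 (d0 / 2)) => //; first by move=> y [].
    by exists x0.
  move=> y _; apply: (@Ck_cont _ _ 0 setT) => //.
  by apply: CkN; [|apply: Ck_sqdist]; exact: openT.
have {}x1P y : C y -> sqdist q x1 <= sqdist q y by move=> /x1P; rewrite lerN2.
have Vx1 := BV _ Bx1.
have x1q : `|x1 - q| <= m.+1%:R * `|x0 - q|.
  apply: rVnorm_le => [|i]; first by rewrite mulr_ge0.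
  rewrite -ler_sqr ?nnegrE ?mulr_ge0 // real_normK ?num_real // !mxE.
  apply: le_trans (sqdist_coord q x1 i) _; apply: le_trans (x1P _ Cx0) _.
  apply: le_trans (sqdist_le _ _) _; rewrite exprMn ler_wpM2r ?sqr_ge0 //.
  by rewrite -natrX ler_nat expnS expn1 (leq_trans (leqnSn m)) // leq_pmulr.
have x1x0 : `|x1 - x0| < d0 / 2.
  rewrite -[x1](subrK q) -addrA (le_lt_trans (ler_normD _ _)) //.
  rewrite (@le_lt_trans _ _ (m.+2%:R * `|x0 - q|)) //.
    by rewrite -[m.+2]addn1 natrD mulrDl mul1r [`|q - _|]distrC lerD2r.
  by rewrite mulrC -ltr_pdivlMr.
pose z := x1 - q.
have z0 : z != 0.
  by rewrite subr_eq0; apply: contraNneq uq => <-; rewrite ux1.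
pose A := \sum_i \sum_j a x1 i j * (z 0 i * z 0 j).
have A0 : 0 < A by exact: ell.
pose S := 6 * (\sum_i a x1 i i) + 4 * \sum_k b x1 k * z 0 k.
(* At [x1] the operator applied to the barrier is [8 * A - kappa * S]. *)
pose kappa := A / (`|S| + 1).
have k0 : 0 < kappa by rewrite divr_gt0 // ltr_pwDr.
pose psi := barrier kappa q x1.
have Cpsi k W : open W -> Ck k W psi by exact: Ck_barrier.
have Lpsi : 0 < elliptic_op a b psi x1.
  have -> : elliptic_op a b psi x1 = 8 * A - kappa * S.
    rewrite /elliptic_op /A.
    have -> : \sum_i \sum_j a x1 i j * partial i (partial j psi) x1 =
       8 * (\sum_i \sum_j a x1 i j * (z 0 i * z 0 j)) - 6 * kappa * \sum_i a x1 i i.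
      rewrite !mulr_sumr -sumrB; apply: eq_bigr => i _.
      have -> : 6 * kappa * a x1 i i = \sum_j 6 * kappa * (a x1 i j * (i == j)%:R).
        rewrite (bigD1 i) //= big1 ?addr0 ?eqxx ?mulr1 // => j ji.
        by rewrite eq_sym (negbTE ji) !mulr0.
      rewrite mulr_sumr -sumrB; apply: eq_bigr => j _.
      by rewrite partial2_barrier /z !mxE; ring.
    have -> : \sum_k b x1 k * partial k psi x1 = - (4 * kappa * \sum_k b x1 k * z 0 k).
      rewrite mulr_sumr -sumrN; apply: eq_bigr => k _.
      by rewrite partial_barrier /z !mxE; ring.
    by rewrite /S; ring.
  have : kappa * S < A.
    apply: le_lt_trans (ler_wpM2l (ltW k0) (ler_norm S)) _.
    by rewrite /kappa mulrAC ltr_pdivrMr ?ltr_pwDr // ltr_pM2l // ltrDl.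
  by move: A0; clearbody A; set w := kappa * S; clearbody w => *; lra.
have psix1 : psi x1 = 0 by rewrite /psi /barrier sqdistxx; ring.
have [d2 d20 near2] : exists2 d2 : R, 0 < d2 & forall y, `|y - x1| < d2 ->
    [/\ V y, 0 < elliptic_op a b psi y, sqdist q y < kappa + sqdist q x1 & `|y - x0| < d0 / 2].
  have n1 : \forall y \near x1, V y by exact: open_nbhs_nbhs.
  have n2 : \forall y \near x1, 0 < elliptic_op a b psi y.
    have := Ck_cont (Ck_elliptic_op Vo (Cpsi 2 V Vo) Ca Cb) Vx1.
    by move=> /(_ [set r | 0 < r]); apply; apply: open_nbhs_nbhs; split => //; exact: open_gt.
  have n3 : \forall y \near x1, sqdist q y < kappa + sqdist q x1.
    have := Ck_cont (Ck_sqdist 0 q (@openT _)) (I : setT x1).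
    move=> /(_ [set r | r < kappa + sqdist q x1]); apply; apply: open_nbhs_nbhs; split.
      exact: open_lt.
    by rewrite /= ltrDr.
  have n4 : \forall y \near x1, `|y - x0| < d0 / 2.
    apply/nbhs_ballP; exists (d0 / 2 - `|x1 - x0|) => /=; first by rewrite subr_gt0.
    move=> y; rewrite -ball_normE /= => yx1.
    rewrite -[y](subrK x1) -addrA (le_lt_trans (ler_normD _ _)) //.
    by rewrite distrC -ltrBrDr.
  have : \forall y \near x1, [/\ V y, 0 < elliptic_op a b psi y,
      sqdist q y < kappa + sqdist q x1 & `|y - x0| < d0 / 2].
    by near=> y; split; near: y.
  move=> /nbhs_ballP[d2 /= d20 d2P]; exists d2 => // y yd; apply: d2P.
  by rewrite -ball_normE /= distrC.
pose V2 := ball x1 d2.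
have V2E y : V2 y -> `|y - x1| < d2 by rewrite /V2 -ball_normE /= distrC.
have V2o : open V2 by exact: ball_open.
have V2V : V2 `<=` V by move=> y /V2E /near2[].
apply: (@no_touching V2 a b p Q u psi x1 (d2 / 2)) => //.
- exact: Ck_sub Cu.
- exact: Cpsi.
- by move=> y /V2V; exact: aQ.
- by move=> y /V2V; exact: Lu.
- by move=> y /V2E /near2[].
- by rewrite divr_gt0.
- move=> y; rewrite /closed_ball_ /V2 -ball_normE /= => yd.
  by apply: le_lt_trans yd _; rewrite ltr_pdivrMr // ltr_pMr // ltr1n.
- by move=> y /V2V; rewrite ux1; exact: umax.
- move=> y /V2E /near2[Vy _ yk yx0] yx1 psiy.
  rewrite lt_neqAle ux1 umax // andbT; apply/negP => /eqP uy.
  have Cy : C y by split=> //; rewrite /B /closed_ball_ /= distrC ltW.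
  have := x1P y Cy => rle.
  have sy : 0 < sqdist x1 y.
    by rewrite lt_neqAle sqdist_ge0 andbT eq_sym; apply: contra_neq yx1 => /sqdist_eq0.
  move: psiy; rewrite /psi /barrier.
  move: yk rle sy k0; clear.
  set r := sqdist q x1; set s := sqdist q y; set t := sqdist x1 y; clearbody r s t kappa.
  move=> yk rle sy k0; apply/negP; rewrite -ltNge.
  by have := mulr_gt0 k0 sy => ?; nra.
Unshelve. all: by end_near.
Qed.

End MaxPrinciple.

(** * The Euclidean inner product *)

Section Dot.
Variables (R : realType) (p : nat).
Implicit Types (v w x : 'rV[R]_p).

Lemma dot_sumE v w : dot v w = \sum_i v 0 i * w 0 i.
Proof. by []. Qed.

Lemma dotC v w : dot v w = dot w v.
Proof. by apply: eq_bigr => i _; rewrite mulrC. Qed.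

Lemma dotE v w : dot v w = (v *m w^T) 0 0.
Proof. by rewrite mxE; apply: eq_bigr => i _; rewrite !mxE. Qed.

Lemma dotDl v w x : dot (v + w) x = dot v x + dot w x.
Proof. by rewrite !dotE mulmxDl mxE. Qed.

Lemma dotZl a v w : dot (a *: v) w = a * dot v w.
Proof. by rewrite !dotE -scalemxAl mxE. Qed.

Lemma dotNl v w : dot (- v) w = - dot v w.
Proof. by rewrite !dotE mulNmx mxE. Qed.

Lemma dotBl v w x : dot (v - w) x = dot v x - dot w x.
Proof. by rewrite dotDl dotNl. Qed.

Lemma dot0l w : dot 0 w = 0.
Proof. by rewrite dotE mul0mx mxE. Qed.

Lemma dot_suml (I : Type) (r : seq I) (P : pred I) (f : I -> 'rV[R]_p) w :
  dot (\sum_(i <- r | P i) f i) w = \sum_(i <- r | P i) dot (f i) w.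
Proof.
by elim/big_rec2: _ => [|i y z _ <-]; [rewrite dot0l|rewrite dotDl].
Qed.

Lemma dotZr a v w : dot w (a *: v) = a * dot w v.
Proof. by rewrite ![dot w _]dotC dotZl. Qed.

Lemma dot_ge0 v : 0 <= dot v v.
Proof. by apply: sumr_ge0 => i _; rewrite -expr2 sqr_ge0. Qed.

Lemma dot_eq0 v : dot v v = 0 -> v = 0.
Proof.
move=> /eqP; rewrite psumr_eq0 => [/allP v0|i _]; last by rewrite -expr2 sqr_ge0.
apply/rowP => i; rewrite mxE.
by have := v0 i (mem_index_enum _); rewrite /= mulf_eq0 orbb => /eqP.
Qed.

Lemma sqr_enorm v : enorm v ^+ 2 = dot v v.
Proof. by rewrite sqr_sqrtr ?dot_ge0. Qed.

End Dot.

(** * Vector-valued maps *)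

Section VectorRules.
Variables (R : realType) (W : normedModType R) (p : nat).
Implicit Types (x v : W) (F G : W -> 'rV[R]_p).

Lemma is_derive_rV F x v (dF : 'rV[R]_p) :
  (forall j, is_derive x v (fun z => F z 0 j) (dF 0 j)) -> is_derive x v F dF.
Proof.
move=> H; have D : derivable F x v.
  by apply/derivable_mxP => a j; rewrite (ord1 a); have [] := H j.
split=> //; apply/rowP => j.
by rewrite (derive_mx D) mxE; have [] := H j.
Qed.

Lemma is_derive_coord F x v dF j :
  is_derive x v F dF -> is_derive x v (fun z => F z 0 j) (dF 0 j).
Proof.
move=> [D E]; split; first by have /derivable_mxP := D; apply.
by rewrite -E (derive_mx D) mxE.
Qed.

Lemma is_derive_dot F G x v dF dG :
  is_derive x v F dF -> is_derive x v G dG ->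
  is_derive x v (fun z => dot (F z) (G z)) (dot dF (G x) + dot (F x) dG).
Proof.
move=> HF HG; rewrite (_ : (fun z => dot _ _) =
  \sum_j ((fun z => F z 0 j) * (fun z => G z 0 j))); last first.
  by apply/funext => z; rewrite fct_sumE.
rewrite (_ : dot dF (G x) + _ = \sum_j (F x 0 j *: dG 0 j + G x 0 j *: dF 0 j)).
  apply: is_derive_sum => j.
  by apply: is_deriveM; exact: is_derive_coord.
by rewrite addrC -big_split /=; apply: eq_bigr => j _; rewrite [dF 0 j * _]mulrC.
Qed.

Lemma is_derive_scale (f : W -> R) F x v (df : R) dF :
  is_derive x v f df -> is_derive x v F dF ->
  is_derive x v (fun z => f z *: F z) (df *: F x + f x *: dF).
Proof.
move=> Hf HF; apply: is_derive_rV => j.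
rewrite (_ : (fun z => _) = f * (fun z => F z 0 j)); last first.
  by apply/funext => z; rewrite mxE.
rewrite (_ : _ 0 j = f x *: dF 0 j + F x 0 j *: df).
  by apply: is_deriveM => //; exact: is_derive_coord.
by rewrite !mxE addrC [df * _]mulrC.
Qed.

End VectorRules.

Section VectorCk.
Variables (R : realType) (m p : nat).
Implicit Types (V : set 'rV[R]_m) (F G : 'rV[R]_m -> 'rV[R]_p).

Definition Ckv k V F := forall j, Ck k V (fun u => F u 0 j).

Lemma Ckv_derivable k V F u i : Ckv k.+1 V F -> V u ->
  derivable F u (delta_mx 0 i).
Proof.
move=> CF Vu; apply/derivable_mxP => a j; rewrite (ord1 a).
exact: Ck_derivable (CF j) Vu.
Qed.

Lemma partial_coordE F u i j : derivable F u (delta_mx 0 i) ->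
  partial i F u 0 j = partial i (fun y => F y 0 j) u.
Proof. by move=> /derive_mx H; rewrite [partial i F u]H mxE. Qed.

Lemma Ckv_partial k V F i : open V -> Ckv k.+1 V F -> Ckv k V (partial i F).
Proof.
move=> Vo CF j; apply: Ck_congr Vo _ (Ck_partial i (CF j)) => u Vu.
by rewrite partial_coordE //; exact: Ckv_derivable CF Vu.
Qed.

Lemma Ck_dot k V F G : open V -> Ckv k V F -> Ckv k V G ->
  Ck k V (fun u => dot (F u) (G u)).
Proof. by move=> Vo CF CG; apply: Ck_sum => // j; exact: CkM Vo (CF j) (CG j). Qed.

Lemma partial_dot k V F G i u : Ckv k.+1 V F -> Ckv k.+1 V G -> V u ->
  partial i (fun y => dot (F y) (G y)) u =
  dot (partial i F u) (G u) + dot (F u) (partial i G u).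
Proof.
move=> CF CG Vu.
have dF := derivableP (Ckv_derivable (i := i) CF Vu).
have dG := derivableP (Ckv_derivable (i := i) CG Vu).
exact: (@derive_val _ _ _ _ _ _ _ (is_derive_dot dF dG)).
Qed.

Lemma partialC_rV V F u i j : open V -> Ckv 2 V F -> V u ->
  partial i (partial j F) u = partial j (partial i F) u.
Proof.
move=> Vo CF Vu; apply/rowP => k.
have d a : derivable (partial a F) u (delta_mx 0 i).
  exact: Ckv_derivable (Ckv_partial a Vo CF) Vu.
have E a b : partial a (partial b F) u 0 k = partial a (partial b (fun y => F y 0 k)) u.
  rewrite partial_coordE; last exact: Ckv_derivable (Ckv_partial b Vo CF) Vu.
  apply: partial_congr Vo _ Vu => y Vy.
  by rewrite partial_coordE //; exact: Ckv_derivable CF Vy.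
exact: etrans (E i j) (etrans (partialC i j Vo (CF k) Vu) (esym (E j i))).
Qed.

Lemma smooth_on_partial V F i : smooth_on V F -> smooth_on V (partial i F).
Proof.
move=> sF s u Vu.
have -> : iter_partial s (partial i F) = iter_partial (rcons s i) F.
  by rewrite /iter_partial foldr_rcons.
exact: sF.
Qed.

Lemma smooth_on_Ckv k V F : open V -> smooth_on V F -> Ckv k V F.
Proof.
move=> Vo; elim: k F => [|k IH] F sF j.
  move=> u Vu; have [cF _] := sF [::] u Vu.
  by apply: (@continuous_comp _ _ _ F (fun v => v 0 j)) => //; exact: coord_continuous.
have dF u i : V u -> derivable F u (delta_mx 0 i).
  by move=> Vu; have [_] := sF [::] u Vu.
split=> [u Vu|i].
  split=> [|i]; last by have /derivable_mxP := dF u i Vu; apply.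
  have [cF _] := sF [::] u Vu.
  by apply: (@continuous_comp _ _ _ F (fun v => v 0 j)) => //; exact: coord_continuous.
apply: Ck_congr Vo _ (IH _ (smooth_on_partial i sF) j) => u Vu.
by rewrite partial_coordE //; exact: dF.
Qed.

End VectorCk.

(** * Gram matrices and their inverses *)

Section MetricAlgebra.
Variables (R : realType).

Lemma tr_mul_trmx (m p : nat) (A : 'M[R]_(m, p)) :
  \tr (A *m A^T) = \sum_i \sum_j A i j ^+ 2.
Proof.
by apply: eq_bigr => i _; rewrite mxE; apply: eq_bigr => j _; rewrite mxE.
Qed.

Lemma tr_mul_trmx_ge0 (m p : nat) (A : 'M[R]_(m, p)) : 0 <= \tr (A *m A^T).
Proof.
rewrite tr_mul_trmx; apply: sumr_ge0 => i _; apply: sumr_ge0 => j _.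
exact: sqr_ge0.
Qed.

Lemma tr_mul_trmx_eq0 (m p : nat) (A : 'M[R]_(m, p)) :
  \tr (A *m A^T) = 0 -> A = 0.
Proof.
rewrite tr_mul_trmx => /eqP.
rewrite psumr_eq0 => [/allP A0|i _]; last by apply: sumr_ge0 => j _; exact: sqr_ge0.
apply/matrixP => i j; rewrite mxE.
have /= := A0 i (mem_index_enum _).
rewrite psumr_eq0 => [/allP Ai0|k _]; last exact: sqr_ge0.
by have := Ai0 j (mem_index_enum _); rewrite /= sqrf_eq0 => /eqP.
Qed.

Variables (m p : nat) (T : 'M[R]_(m, p)).
Hypothesis Tfree : row_free T.
Let G := T *m T^T.

Lemma gram_sym : G^T = G.
Proof. by rewrite /G trmx_mul trmxK. Qed.

(** If [z T T^T = 0] then [|z T|^2 = 0]. *)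
Lemma gram_unit : G \in unitmx.
Proof.
rewrite -row_free_unit -kermx_eq0.
set K := kermx G.
have KG : K *m G = 0 by exact: mulmx_ker.
have KT : K *m T = 0.
  apply: tr_mul_trmx_eq0.
  by rewrite trmx_mul !mulmxA -(mulmxA K T) -/G KG mul0mx linear0.
by apply/eqP/(row_free_inj Tfree); rewrite mul0mx.
Qed.

Lemma invgram_sym : (invmx G)^T = invmx G.
Proof. by rewrite trmx_inv gram_sym. Qed.

Let Q := invmx G *m T.

(** An explicit square root of the inverse metric.  It replaces a
    diagonalization: ellipticity of the Laplacian and positivity of metric traces
    both follow from it. *)
Lemma invgramE : invmx G = Q *m Q^T.
Proof.
rewrite /Q trmx_mul invgram_sym mulmxA -(mulmxA _ T) -/G.
by rewrite mulVmx ?gram_unit // mul1mx.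
Qed.

Lemma invgram_pos (z : 'rV[R]_m) : z != 0 ->
  0 < \sum_i \sum_j invmx G i j * (z 0 i * z 0 j).
Proof.
move=> z0; have -> : \sum_i \sum_j invmx G i j * (z 0 i * z 0 j) =
    \tr ((z *m Q) *m (z *m Q)^T).
  have -> : (z *m Q) *m (z *m Q)^T = z *m invmx G *m z^T.
    by rewrite [in RHS]invgramE trmx_mul !mulmxA.
  rewrite /mxtrace big_ord1 mxE.
  rewrite exchange_big /=; apply: eq_bigr => j _.
  rewrite !mxE mulr_suml; apply: eq_bigr => i _.
  by rewrite mulrA [_ * z 0 i]mulrC.
rewrite lt_neqAle tr_mul_trmx_ge0 andbT eq_sym; apply: contra_neq z0.
move=> /tr_mul_trmx_eq0; rewrite /Q mulmxA => zQ.
have : z *m invmx G = 0 by apply: (row_free_inj Tfree); rewrite zQ mul0mx.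
by move=> /(congr1 (mulmx^~ G)); rewrite mulmxKV ?gram_unit // mul0mx.
Qed.

Lemma tr_invgram_ge0 (k : nat) (N : 'M[R]_(m, k)) :
  0 <= \tr (invmx G *m (N *m N^T)).
Proof.
rewrite invgramE -mulmxA mxtrace_mulC; move: Q => q.
have -> : q^T *m (N *m N^T) *m q = (q^T *m N) *m (q^T *m N)^T.
  by rewrite trmx_mul trmxK !mulmxA.
exact: tr_mul_trmx_ge0.
Qed.

Lemma tr_invgram_eq0 (k : nat) (N : 'M[R]_(m, k)) :
  \tr (invmx G *m (N *m N^T)) = 0 -> N = 0.
Proof.
rewrite invgramE -mulmxA mxtrace_mulC.
have -> : Q^T *m (N *m N^T) *m Q = (Q^T *m N) *m (Q^T *m N)^T.
  by rewrite [(_ *m N)^T]trmx_mul trmxK !mulmxA.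
move=> /tr_mul_trmx_eq0 /(congr1 (mulmx T)).
rewrite mulmx0 /Q trmx_mul invgram_sym !mulmxA -/G mulmxV ?gram_unit //.
by rewrite mul1mx.
Qed.

Lemma tr_sym_invgram_ge0 (S : 'M[R]_m) : S^T = S ->
  0 <= \tr (S *m invmx G *m (S *m invmx G)).
Proof.
move=> Ss; rewrite invgramE; move: Q => q.
have -> : \tr (S *m (q *m q^T) *m (S *m (q *m q^T))) =
    \tr ((q^T *m S *m q) *m (q^T *m S *m q)^T).
  rewrite !trmx_mul trmxK Ss !mulmxA mxtrace_mulC.
  by rewrite !mulmxA.
exact: tr_mul_trmx_ge0.
Qed.

(** Expand [0 <= |A - t id|^2] for the self-adjoint endomorphism [A = S G^-1], with
    [t] the mean of its eigenvalues. *)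
Lemma sqr_tr_invgram (S : 'M[R]_m) : S^T = S ->
  \tr (S *m invmx G) ^+ 2 <= m%:R * \tr (S *m invmx G *m (S *m invmx G)).
Proof.
move=> Ss.
have [m0|m0] := posnP m.
  have -> : \tr (S *m invmx G) = 0.
    rewrite /mxtrace big1 // => i _.
    have im := leq_ltn_trans (leq0n i) (ltn_ord i).
    by exfalso; move: im; rewrite m0.
  by rewrite expr0n mulr_ge0 ?ler0n ?tr_sym_invgram_ge0.
have mR : 0 < m%:R :> R by rewrite ltr0n.
pose t := \tr (S *m invmx G) / m%:R.
have := @tr_sym_invgram_ge0 (S - t *: G).
rewrite linearB /= linearZ /= gram_sym Ss => /(_ erefl).
rewrite mulmxBl -scalemxAl mulmxV ?gram_unit //.
set A := S *m invmx G.
have -> : \tr ((A - t *: 1%:M) *m (A - t *: 1%:M)) = \tr (A *m A) - \tr A ^+ 2 / m%:R.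
  rewrite mulmxBl !mulmxBr -!scalemxAl -!scalemxAr !mul1mx !mulmx1.
  rewrite !linearB /= !mxtraceZ mxtrace1 /t -/A.
  move: (m%:R : R) (lt0r_neq0 mR) => c c0.
  by clearbody A; field.
by rewrite subr_ge0 ler_pdivrMr // mulrC.
Qed.

End MetricAlgebra.

(** * Curvature of the sphere *)

Section SphereCurvature.
Variables (R : realType) (n : nat).
Implicit Types (y v w z : 'rV[R]_n.+1).

Lemma is_derive_sphere_proj (Y Z : 'rV[R]_n.+1 -> 'rV[R]_n.+1) y v dY dZ :
  is_derive y v Y dY -> is_derive y v Z dZ ->
  is_derive y v (fun z => sphere_proj (Y z) (Z z))
    (dZ - ((dot dZ (Y y) + dot (Z y) dY) *: Y y + dot (Z y) (Y y) *: dY)).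
Proof.
move=> HY HZ; apply: is_deriveB.
by apply: is_derive_scale => //; exact: is_derive_dot.
Qed.

Lemma is_derive_proj_cst y v w :
  is_derive y v (fun z => sphere_proj z w) (- (dot w v *: y + dot w y *: v)).
Proof.
have := is_derive_sphere_proj (is_derive_id y v) (is_derive_cst w y v).
by rewrite dot0l !add0r.
Qed.

Lemma sphere_nabla_proj v w :
  sphere_nabla (fun z => sphere_proj z v) (fun z => sphere_proj z w) =
  fun z => sphere_proj z
    (- (dot w (sphere_proj z v) *: z + dot w z *: sphere_proj z v)).
Proof.
apply/funext => z; rewrite /sphere_nabla.
by rewrite (@derive_val _ _ _ _ _ _ _ (is_derive_proj_cst _ _ _)).
Qed.

Lemma sphere_proj_id y v : dot v y = 0 -> sphere_proj y v = v.
Proof. by move=> vy; rewrite /sphere_proj vy scale0r subr0. Qed.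

Lemma sphere_nabla2 y v1 v2 v3 : dot y y = 1 ->
  dot v1 y = 0 -> dot v2 y = 0 -> dot v3 y = 0 ->
  sphere_nabla (fun z => sphere_proj z v1)
    (sphere_nabla (fun z => sphere_proj z v2) (fun z => sphere_proj z v3)) y
  = - (dot v3 v1 *: v2).
Proof.
move=> yy y1 y2 y3; rewrite sphere_nabla_proj /sphere_nabla (sphere_proj_id y1).
have D2 := is_derive_proj_cst y v1 v2; rewrite y2 scale0r addr0 in D2.
have C3 : is_derive y v1 (fun=> v3) 0 by exact: is_derive_cst.
have Did : is_derive y v1 id v1 by exact: is_derive_id.
have DW : is_derive y v1
    (fun z => - (dot v3 (sphere_proj z v2) *: z + dot v3 z *: sphere_proj z v2))
    (- (dot v3 v2 *: v1 + dot v3 v1 *: v2)).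
  have y3' : dot v3 (- (dot v2 v1 *: y)) = 0 by rewrite -scaleNr dotZr y3 mulr0.
  rewrite (_ : - _ = - (((dot 0 (sphere_proj y v2) + dot v3 (- (dot v2 v1 *: y))) *: y
      + dot v3 (sphere_proj y v2) *: v1)
    + ((dot 0 y + dot v3 v1) *: sphere_proj y v2
      + dot v3 y *: - (dot v2 v1 *: y)))).
    exact: (is_deriveN (is_deriveD (is_derive_scale (is_derive_dot C3 D2) Did)
      (is_derive_scale (is_derive_dot C3 Did) D2))).
  by rewrite (sphere_proj_id y2) y3' y3 !dot0l addr0 !scale0r !add0r addr0.
have D := is_derive_sphere_proj Did DW.
rewrite (@derive_val _ _ _ _ _ _ _ D) /= (sphere_proj_id y2) y3 scale0r addr0.
rewrite !dotNl !dotDl !dotZl y1 y2 yy [dot y v1]dotC y1 !mulr0 !addr0 oppr0 add0r mulr1.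
rewrite /sphere_proj scale0r add0r.
rewrite scaleNr opprK opprD [_ + dot v3 v2 *: v1]addrC addNKr.
by rewrite dotNl dotZl y2 mulr0 oppr0 scale0r subr0.
Qed.

(** The sphere has constant curvature 1.  The tangent fields extending [v1] and
    [v2] have derivative a multiple of [y] at [y], so that their bracket vanishes
    there and only the two iterated derivatives remain. *)
Lemma sphere_curvatureE y v1 v2 v3 : dot y y = 1 ->
  dot v1 y = 0 -> dot v2 y = 0 -> dot v3 y = 0 ->
  sphere_curvature y v1 v2 v3 = dot v3 v2 *: v1 - dot v3 v1 *: v2.
Proof.
move=> yy y1 y2 y3; rewrite /sphere_curvature !sphere_nabla2 // opprK.
rewrite [X in _ - X](_ : _ = 0) ?subr0 1?addrC //.
rewrite /sphere_nabla /lie_bracket (sphere_proj_id y1) (sphere_proj_id y2).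
rewrite (@derive_val _ _ _ _ _ _ _ (is_derive_proj_cst y v1 v2)).
rewrite (@derive_val _ _ _ _ _ _ _ (is_derive_proj_cst y v2 v1)).
rewrite y1 y2 !scale0r !addr0 [dot v1 v2]dotC subrr derive0.
by rewrite /sphere_proj dot0l scale0r subr0.
Qed.

End SphereCurvature.

(** * Local geometry of a submanifold of the sphere *)

Opaque partial dot.

Section LocalGeometry.
Variables (R : realType) (m n : nat) (V : set 'rV[R]_m).
Variable F : 'rV[R]_m -> 'rV[R]_n.+1.
Hypothesis Vo : open V.
Hypothesis CF : forall k, Ckv k V F.
Hypothesis FS : forall u, V u -> dot (F u) (F u) = 1.
Hypothesis Ffree : forall u, V u -> row_free (tangent_frame F u).
Let G := first_form F.
Let T := tangent_frame F.
Let tau := tension G F.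

Lemma first_formE u : G u = T u *m (T u)^T.
Proof.
by apply/matrixP => i j; rewrite !mxE dot_sumE; apply: eq_bigr => k _; rewrite !mxE.
Qed.

Lemma first_form_sym u : (G u)^T = G u.
Proof. by rewrite first_formE gram_sym. Qed.

Lemma first_form_unit u : V u -> G u \in unitmx.
Proof. by move=> Vu; rewrite first_formE gram_unit //; exact: Ffree. Qed.

Lemma inv_first_form_sym u : (invmx (G u))^T = invmx (G u).
Proof. by rewrite trmx_inv first_form_sym. Qed.

Lemma dot_partial_F u i : V u -> dot (partial i F u) (F u) = 0.
Proof.
move=> Vu; have := partial_dot i (CF 1) (CF 1) Vu.
rewrite (partial_congr i Vo FS Vu) partial_cst [dot (F u) _]dotC => /eqP.
by rewrite eq_sym -mulr2n mulrn_eq0 => /eqP.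
Qed.

Lemma partial_first_form u i j k : V u ->
  partial k (fun z => G z i j) u =
    dot (partial k (partial i F) u) (partial j F u)
    + dot (partial i F u) (partial k (partial j F) u).
Proof.
move=> Vu; rewrite (_ : (fun z => _) = fun z => dot (partial i F z) (partial j F z)).
  exact: partial_dot (Ckv_partial i Vo (CF 2)) (Ckv_partial j Vo (CF 2)) Vu.
by apply/funext => z; rewrite mxE.
Qed.

(** The derivatives of the metric are products of first and second derivatives of
    [F]; by the symmetry of the latter all but one of them cancel. *)
Lemma christoffelE u k i j : V u -> christoffel G k i j u =
  \sum_l invmx (G u) k l * dot (partial i (partial j F) u) (partial l F u).
Proof.
move=> Vu; rewrite /christoffel mulr_sumr; apply: eq_bigr => l _.
rewrite (partial_first_form j l i Vu) (partial_first_form i l j Vu).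
rewrite (partial_first_form i j l Vu).
(* Abstracting the derivatives of [F] leaves an identity between inner
   products. *)
suff key (e : 'I_m -> 'rV[R]_n.+1) (h : 'I_m -> 'I_m -> 'rV[R]_n.+1) (c : R) :
    (forall a b, h a b = h b a) ->
    2^-1 * (c * (dot (h i j) (e l) + dot (e j) (h i l)
      + (dot (h j i) (e l) + dot (e i) (h j l))
      - (dot (h l i) (e j) + dot (e i) (h l j)))) = c * dot (h i j) (e l).
  exact: (key (fun a => partial a F u) (fun a b => partial a (partial b F) u) _
            (fun a b => partialC_rV a b Vo (CF 2) Vu)).
move=> hC; rewrite (hC j i) (hC l i) (hC l j) [dot (e j) _]dotC [dot (e i) _]dotC.
by field.
Qed.

(** In terms of the frame [T], the tangential projection is [T^T G^-1 T]. *)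
Lemma normal_projE u w : normal_proj F u w =
  sphere_proj (F u) w - w *m (T u)^T *m invmx (G u) *m T u.
Proof.
rewrite /normal_proj; congr (_ - _); apply/rowP => c.
rewrite /metric_trace mxE summxE.
under [LHS]eq_bigr => i _ do rewrite summxE.
rewrite exchange_big; apply: eq_bigr => j _ /=.
rewrite [(w *m _ *m _) 0 j]mxE mulr_suml; apply: eq_bigr => i _.
rewrite !mxE mulrA; congr (_ * _); rewrite mulrC; congr (_ * _).
by rewrite dot_sumE; apply: eq_bigr => k _; rewrite !mxE.
Qed.

Lemma mul_tangent_trmx u w i : (w *m (T u)^T) 0 i = dot w (partial i F u).
Proof. by rewrite mxE dot_sumE; apply: eq_bigr => k _; rewrite !mxE. Qed.

Lemma F_tangent u : V u -> F u *m (T u)^T = 0.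
Proof.
by move=> Vu; apply/rowP => i; rewrite mul_tangent_trmx dotC dot_partial_F // mxE.
Qed.

Lemma sphere_proj_tangent u w : V u -> sphere_proj (F u) w *m (T u)^T = w *m (T u)^T.
Proof. by move=> Vu; rewrite mulmxBl -scalemxAl F_tangent // scaler0 subr0. Qed.

Lemma normal_proj_tangent u w : V u -> normal_proj F u w *m (T u)^T = 0.
Proof.
move=> Vu; rewrite normal_projE mulmxBl sphere_proj_tangent //.
by rewrite -(mulmxA _ (T u)) -first_formE mulmxKV ?first_form_unit // subrr.
Qed.

Lemma dot_normal_proj_partial u w i : V u -> dot (normal_proj F u w) (partial i F u) = 0.
Proof. by move=> Vu; rewrite -mul_tangent_trmx normal_proj_tangent // mxE. Qed.

Lemma dot_normal_proj_F u w : V u -> dot (normal_proj F u w) (F u) = 0.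
Proof.
move=> Vu; rewrite normal_projE dotBl !dotBl dotZl FS // mulr1 subrr sub0r.
rewrite dotE -mulmxA (_ : T u *m (F u)^T = 0) ?mulmx0 ?mxE ?oppr0 //.
by rewrite -[LHS]trmxK trmx_mul trmxK F_tangent // trmx0.
Qed.

Lemma normal_proj_sphere_proj u w : V u ->
  normal_proj F u (sphere_proj (F u) w) = normal_proj F u w.
Proof.
move=> Vu; rewrite !normal_projE sphere_proj_tangent //; congr (_ - _).
by rewrite sphere_proj_id // dotBl dotZl FS // mulr1 subrr.
Qed.

(** Gauss: the Christoffel term is the tangential part of the second derivative,
    so that [nabla d F] is the second fundamental form. *)
Lemma nabla_dE u i j : V u ->
  nabla_d G F u i j = normal_proj F u (partial i (partial j F) u).
Proof.
move=> Vu; rewrite normal_projE /nabla_d /pullback_nabla; congr (_ - _).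
apply/rowP => c; rewrite summxE [RHS]mxE; apply: eq_bigr => k _.
rewrite !mxE christoffelE //; congr (_ * _); apply: eq_bigr => l _.
by rewrite mul_tangent_trmx mulrC -[in LHS]inv_first_form_sym mxE.
Qed.

Lemma second_formE u i j : V u ->
  second_form F u i j = normal_proj F u (partial i (partial j F) u).
Proof. by move=> Vu; rewrite /second_form normal_proj_sphere_proj. Qed.

Lemma tensionE u : V u -> tau u = metric_trace (G u) (second_form F u).
Proof.
move=> Vu; apply: eq_bigr => i _; apply: eq_bigr => j _.
by rewrite nabla_dE // second_formE.
Qed.

Lemma mean_curvatureE u : V u -> mean_curvature F u = m%:R^-1 *: tau u.
Proof. by move=> Vu; rewrite tensionE. Qed.

Lemma dot_metric_trace u (B : 'I_m -> 'I_m -> 'rV[R]_n.+1) w :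
  dot (metric_trace (G u) B) w = \sum_i \sum_j invmx (G u) i j * dot (B i j) w.
Proof.
rewrite dot_suml; apply: eq_bigr => i _; rewrite dot_suml.
by apply: eq_bigr => j _; rewrite dotZl.
Qed.

Lemma dot_tau_F u : V u -> dot (tau u) (F u) = 0.
Proof.
move=> Vu; rewrite tensionE // dot_metric_trace big1 // => i _; rewrite big1 // => j _.
by rewrite second_formE // dot_normal_proj_F // mulr0.
Qed.

Lemma dot_tau_partial u k : V u -> dot (tau u) (partial k F u) = 0.
Proof.
move=> Vu; rewrite tensionE // dot_metric_trace big1 // => i _; rewrite big1 // => j _.
by rewrite second_formE // dot_normal_proj_partial // mulr0.
Qed.

Lemma dot_normal_proj_tau u w : V u -> dot (normal_proj F u w) (tau u) = dot w (tau u).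
Proof.
move=> Vu; rewrite normal_projE dotBl /sphere_proj dotBl dotZl [dot (F u) _]dotC.
rewrite dot_tau_F // mulr0 subr0 [dot (_ *m _) _]dotE -mulmxA (_ : T u *m (tau u)^T = 0).
  by rewrite mulmx0 mxE subr0.
rewrite -[LHS]trmxK trmx_mul trmxK (_ : tau u *m (T u)^T = 0) ?trmx0 //.
by apply/rowP => i; rewrite mul_tangent_trmx dot_tau_partial // mxE.
Qed.

Lemma Ck_first_form k i j : Ck k V (fun u => G u i j).
Proof.
rewrite (_ : (fun u => _) = fun u => dot (partial i F u) (partial j F u)).
  exact: Ck_dot Vo (Ckv_partial i Vo (CF _)) (Ckv_partial j Vo (CF _)).
by apply/funext => u; rewrite mxE.
Qed.

Lemma Ck_inv_first_form k i j : Ck k V (fun u => invmx (G u) i j).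
Proof.
exact: (Ck_invmx Vo (fun u Vu => first_form_unit Vu) (Ck_first_form k) i j).
Qed.

Lemma Ck_christoffel k l i j : Ck k V (christoffel G l i j).
Proof.
apply: Ck_congr Vo (fun u Vu => esym (christoffelE l i j Vu)) _.
apply: Ck_sum Vo _ => a; apply: CkM Vo (Ck_inv_first_form k l a) _.
exact: Ck_dot Vo (Ckv_partial i Vo (Ckv_partial j Vo (CF _))) (Ckv_partial a Vo (CF _)).
Qed.

Lemma Ckv_tau k : Ckv k V tau.
Proof.
move=> c; pose D i j u := partial i (partial j F) u.
have CD i j : Ckv k V (D i j) by exact: Ckv_partial Vo (Ckv_partial j Vo (CF _)).
have CFc : Ck k V (fun u => F u 0 c) := CF k c.
pose t u := \sum_i \sum_j invmx (G u) i j *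
   (D i j u 0 c - dot (D i j u) (F u) * F u 0 c
    - \sum_l christoffel G l i j u * partial l F u 0 c).
apply: (@Ck_congr _ _ _ _ t) Vo _ _ => [u Vu|].
  rewrite /t /tau /tension /metric_trace summxE; apply: eq_bigr => i _.
  rewrite summxE; apply: eq_bigr => j _; rewrite !mxE summxE; congr (_ * (_ - _)).
  by apply: eq_bigr => l _; rewrite mxE.
apply: Ck_sum Vo _ => i; apply: Ck_sum Vo _ => j.
apply: CkM Vo (Ck_inv_first_form k i j) _.
apply: CkB Vo _ _.
  exact: CkB Vo (CD i j c) (CkM Vo (Ck_dot Vo (CD i j) (CF k)) CFc).
apply: Ck_sum Vo _ => l; apply: CkM Vo (Ck_christoffel k l i j) _.
exact: Ckv_partial Vo (CF _) c.
Qed.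

Lemma dot_partial_tau_F u i : V u -> dot (partial i tau u) (F u) = 0.
Proof.
move=> Vu; have := partial_dot i (Ckv_tau 1) (CF 1) Vu.
rewrite (partial_congr i Vo (fun y Vy => dot_tau_F Vy) Vu) partial_cst.
by rewrite dot_tau_partial // addr0.
Qed.

(** The form of the shape operator [A_tau], whose matrix is
    [shape_form *m invmx G]. *)
Definition shape_form u : 'M[R]_m := \matrix_(i, j) dot (second_form F u i j) (tau u).

Lemma shape_form_sym u : V u -> (shape_form u)^T = shape_form u.
Proof.
move=> Vu; apply/matrixP => i j.
have E a b : shape_form u a b =
    dot (normal_proj F u (partial a (partial b F) u)) (tau u).
  by rewrite mxE second_formE.
rewrite mxE; apply: etrans (E j i) (etrans _ (esym (E i j))).
exact: (congr1 (fun w => dot (normal_proj F u w) (tau u))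
          (partialC_rV j i Vo (CF 2) Vu)).
Qed.

Lemma shape_formE u i j : V u ->
  shape_form u i j = dot (partial i (partial j F) u) (tau u).
Proof. by move=> Vu; rewrite mxE second_formE // dot_normal_proj_tau. Qed.

Lemma dot_partial_tau_partial u i k : V u ->
  dot (partial i tau u) (partial k F u) = - shape_form u i k.
Proof.
move=> Vu; have := partial_dot i (Ckv_tau 1) (Ckv_partial k Vo (CF 2)) Vu.
rewrite (partial_congr i Vo (fun y Vy => dot_tau_partial k Vy) Vu) partial_cst.
move=> /esym/eqP; rewrite addr_eq0 shape_formE // => /eqP E.
exact: etrans E (congr1 -%R (dotC _ _)).
Qed.

(** As [tau] is orthogonal to [F] and to the tangent plane, its derivatives are
    orthogonal to [F]: the connection of the sphere acts on [tau] as the flat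
    one. *)
Lemma pullback_nabla_tau u j : V u -> pullback_nabla F j tau u = partial j tau u.
Proof. by move=> Vu; apply: sphere_proj_id; rewrite dot_partial_tau_F. Qed.

Lemma dot_nabla2_tau u i j : V u -> dot (nabla2 G F tau u i j) (tau u) =
  dot (partial i (partial j tau) u) (tau u)
  - \sum_k christoffel G k i j u * dot (partial k tau u) (tau u).
Proof.
move=> Vu; rewrite /nabla2 dotBl; congr (_ - _).
  rewrite {1}/pullback_nabla (partial_congr i Vo (fun y Vy => pullback_nabla_tau j Vy) Vu).
  by rewrite dotBl dotZl [dot (F u) _]dotC dot_tau_F // mulr0 subr0.
rewrite dot_suml; apply: eq_bigr => k _.
by rewrite dotZl pullback_nabla_tau.
Qed.

(** In constant curvature only the trace of the metric times [tau] survives,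
    because [tau] is normal. *)
Lemma curvature_trace u : V u ->
  metric_trace (G u) (fun i j =>
      sphere_curvature (F u) (partial i F u) (tau u) (partial j F u)) =
  - (m%:R *: tau u).
Proof.
move=> Vu.
have -> : m%:R = \sum_i \sum_j invmx (G u) i j * G u j i.
  rewrite -(mxtrace1 R m) -(mulVmx (first_form_unit Vu)).
  by apply: eq_bigr => i _; rewrite mxE.
rewrite scaler_suml -sumrN; apply: eq_bigr => i _.
rewrite scaler_suml -sumrN; apply: eq_bigr => j _.
rewrite sphere_curvatureE ?FS ?dot_partial_F ?dot_tau_F //.
rewrite [dot _ (tau u)]dotC dot_tau_partial // scale0r sub0r scalerN -scalerA.
by rewrite [G u j i]mxE.
Qed.

(** First order coefficients of the Laplace-Beltrami operator. *)
Definition laplace_drift u (k : 'I_m) : R :=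
  - \sum_i \sum_j invmx (G u) i j * christoffel G k i j u.

(** The squared length of the full derivative of [tau], tangential part included. *)
Definition grad_tau_sqr u : R :=
  \sum_i \sum_j invmx (G u) i j * dot (partial i tau u) (partial j tau u).

(** The Laplacian of [|tau|^2] is twice the sum of [<trace nabla^2 tau, tau>] and
    [|d tau|^2], and the biharmonic equation reads [trace nabla^2 tau = - m tau]. *)
Lemma laplace_sqr_tau u : V u -> bitension G F u = 0 ->
  elliptic_op (fun y => invmx (G y)) laplace_drift (fun y => dot (tau y) (tau y)) u =
  2 * (grad_tau_sqr u - m%:R * dot (tau u) (tau u)).
Proof.
move=> Vu bi.
have C2 := Ckv_tau 2.
have p1 k y : V y -> partial k (fun y => dot (tau y) (tau y)) y
    = 2 * dot (partial k tau y) (tau y).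
  move=> Vy; rewrite (partial_dot k C2 C2 Vy) [dot (tau y) _]dotC.
  by rewrite mulr_natl mulr2n.
have p2 i j : partial i (partial j (fun y => dot (tau y) (tau y))) u
    = 2 * (dot (partial i (partial j tau) u) (tau u)
           + dot (partial i tau u) (partial j tau u)).
  rewrite (partial_congr i Vo (fun y Vy => p1 j y Vy) Vu).
  have Cj := Ckv_partial j Vo C2.
  have C1 := Ck_dot Vo Cj (Ckv_tau 1).
  rewrite (partialM i (Ck_cst 1 V 2) C1 Vu).
  rewrite partial_cst mul0r add0r (partial_dot i Cj (Ckv_tau 1) Vu).
  exact: (congr1 (fun r => 2 * (dot (partial i (partial j tau) u) (tau u) + r))
            (dotC (partial j tau u) (partial i tau u))).
have trE : \sum_i \sum_j invmx (G u) i j * dot (nabla2 G F tau u i j) (tau u)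
    = - (m%:R * dot (tau u) (tau u)).
  rewrite -dot_metric_trace -dotZl -dotNl -curvature_trace //; congr dot.
  move: bi => /eqP; rewrite /bitension /rough_laplacian opprK subr_eq0 => /eqP.
  exact.
rewrite /elliptic_op mulrDr -trE addrC.
rewrite (_ : \sum_k laplace_drift u k * _ =
  - \sum_i \sum_j invmx (G u) i j *
     \sum_k christoffel G k i j u * (2 * dot (partial k tau u) (tau u))); last first.
  rewrite -sumrN; under [RHS]eq_bigr => i _ do rewrite -sumrN.
  under [RHS]eq_bigr => i _ do under eq_bigr => j _ do rewrite mulr_sumr -sumrN.
  under [RHS]eq_bigr => i _ do rewrite exchange_big.
  rewrite [RHS]exchange_big /=; apply: eq_bigr => k _.
  rewrite p1 // /laplace_drift mulNr mulr_suml -sumrN; apply: eq_bigr => i _.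
  rewrite mulr_suml -sumrN; apply: eq_bigr => j _.
  by rewrite -mulrA.
rewrite /grad_tau_sqr !mulr_sumr -sumrN -!big_split; apply: eq_bigr => i _ /=.
rewrite !mulr_sumr -sumrN -!big_split; apply: eq_bigr => j _ /=.
rewrite p2 dot_nabla2_tau //.
have -> : \sum_k christoffel G k i j u * (2 * dot (partial k tau u) (tau u))
   = 2 * \sum_k christoffel G k i j u * dot (partial k tau u) (tau u).
  by rewrite mulr_sumr; apply: eq_bigr => k _; rewrite mulrCA.
by ring.
Qed.

Definition normal_nabla_tau u : 'M[R]_(m, n.+1) := \matrix_i normal_nabla F i tau u.

(** Weingarten: the tangential part of the derivative of [tau] is [- A_tau], its
    normal part is the normal derivative; the two are orthogonal. *)
Lemma grad_tau_sqrE u : V u -> grad_tau_sqr u =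
  \tr (shape_form u *m invmx (G u) *m (shape_form u *m invmx (G u)))
  + \tr (invmx (G u) *m (normal_nabla_tau u *m (normal_nabla_tau u)^T)).
Proof.
move=> Vu; set S := shape_form u; set N := normal_nabla_tau u.
pose D : 'M[R]_(m, n.+1) := \matrix_i partial i tau u.
have DT : D *m (T u)^T = - S.
  apply/matrixP => i k; rewrite mxE [RHS]mxE -dot_partial_tau_partial // dot_sumE.
  by apply: eq_bigr => a _; rewrite !mxE.
have NE : N = D + S *m invmx (G u) *m T u.
  apply/row_matrixP => i; rewrite linearD /= !rowK /normal_nabla.
  rewrite pullback_nabla_tau // normal_projE sphere_proj_id ?dot_partial_tau_F //.
  have rS : row i S = - (partial i tau u *m (T u)^T).
    by rewrite -[S]opprK -DT linearN /= row_mul rowK.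
  by rewrite !row_mul rS !mulNmx.
have NT : N *m (T u)^T = 0.
  by apply/row_matrixP => i; rewrite row_mul rowK row0 normal_proj_tangent.
(* [D] has the derivatives of [tau] as rows. *)
have DE : D = N - S *m invmx (G u) *m T u by rewrite NE addrK.
have -> : grad_tau_sqr u = \tr (invmx (G u) *m (D *m D^T)).
  rewrite /grad_tau_sqr; apply: eq_bigr => i _; rewrite mxE; apply: eq_bigr => j _.
  congr (_ * _); rewrite mxE dotC dot_sumE; apply: eq_bigr => k _.
  by rewrite !mxE mulrC.
have -> : D *m D^T = N *m N^T + S *m invmx (G u) *m S.
  have TN : T u *m N^T = 0 by rewrite -[LHS]trmxK trmx_mul trmxK NT trmx0.
  rewrite DE linearB /= !trmx_mul inv_first_form_sym shape_form_sym //.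
  rewrite mulmxBl !mulmxBr !mulmxA NT !mul0mx subr0.
  rewrite -(mulmxA _ (T u) N^T) TN mulmx0 sub0r opprK.
  rewrite -(mulmxA _ (T u) (T u)^T) -first_formE.
  by rewrite mulmxKV ?first_form_unit.
rewrite mulmxDr linearD /= addrC; congr (_ + _).
by rewrite -/S mxtrace_mulC !mulmxA.
Qed.

End LocalGeometry.

(** * The mean curvature vector does not depend on the chart *)

Lemma congr_invmx (R : realType) (m : nat) (J G : 'M[R]_m) :
  J \in unitmx -> G \in unitmx ->
  J^T *m invmx (J *m G *m J^T) *m J = invmx G.
Proof.
move=> Ju Gu; set X := _ *m J.
have G1u : J *m G *m J^T \in unitmx by rewrite !unitmx_mul unitmx_tr Ju Gu.
have XG : X *m G *m J^T = J^T.
  by rewrite /X -!mulmxA (mulmxA J) mulVmx // mulmx1.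
have {}XG : X *m G = 1%:M.
  have Jt : J^T \in unitmx by rewrite unitmx_tr.
  by rewrite -[LHS](mulmxK Jt) XG mulmxV.
by rewrite -[LHS](mulmxK Gu) XG mul1mx.
Qed.

(** The trace of a bilinear form with respect to a metric is invariant under a
    change of frame. *)
Lemma congr_trace (R : realType) (m : nat) (W : normedModType R) (J g : 'M[R]_m)
    (B1 B : 'I_m -> 'I_m -> W) :
  (forall i j, B1 i j = \sum_a \sum_b (J i b * J j a) *: B b a) ->
  \sum_i \sum_j g i j *: B1 i j
    = \sum_b \sum_a (J^T *m g *m J) b a *: B b a.
Proof.
move=> B1E.
transitivity (\sum_i \sum_j \sum_b \sum_a (g i j * (J i b * J j a)) *: B b a).
  apply: eq_bigr => i _; apply: eq_bigr => j _.
  rewrite B1E exchange_big /= scaler_sumr; apply: eq_bigr => b _.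
  by rewrite scaler_sumr; apply: eq_bigr => a _; rewrite scalerA.
under eq_bigr => i _ do rewrite exchange_big.
rewrite exchange_big; apply: eq_bigr => b _ /=.
under eq_bigr => i _ do rewrite exchange_big.
rewrite exchange_big; apply: eq_bigr => a _ /=.
under eq_bigr => i _ do rewrite -scaler_suml.
rewrite -scaler_suml; congr (_ *: _).
rewrite mxE exchange_big; apply: eq_bigr => j _ /=.
rewrite mxE mulr_suml; apply: eq_bigr => i _.
by rewrite [J^T b i]mxE; ring.
Qed.

Section ChainRule.
Variables (R : realType) (m p : nat) (V : set 'rV[R]_m).
Variable H : 'rV[R]_m -> 'rV[R]_p.
Hypothesis Vo : open V.
Hypothesis CH : Ckv 1 V H.

Lemma is_derive_chain (phi : 'rV[R]_m -> 'rV[R]_m) u v :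
  V (phi u) -> derivable phi u v ->
  is_derive u v (H \o phi) (\sum_b ('D_v phi u) 0 b *: partial b H (phi u)).
Proof.
move=> Vu dphi; apply: is_derive_rV => c.
have Hd := Ck_is_diff Vo (CH c) Vu.
have dd : differentiable (fun y => H y 0 c) (phi u) by apply: ex_diff.
have := is_derive_comp_diff dd dphi.
rewrite (@diff_val _ _ _ _ _ _ _ Hd) /grad_form.
rewrite (_ : \sum_i _ = (\sum_b ('D_v phi u) 0 b *: partial b H (phi u)) 0 c) //.
rewrite summxE; apply: eq_bigr => b _; rewrite mxE partial_coordE //.
exact: Ckv_derivable CH Vu.
Qed.

End ChainRule.

Section Reparametrization.
Variables (R : realType) (m n : nat) (U V : set 'rV[R]_m).
Variables (F F1 : 'rV[R]_m -> 'rV[R]_n.+1) (phi : 'rV[R]_m -> 'rV[R]_m).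
Hypothesis Uo : open U.
Hypothesis Vo : open V.
Hypothesis CF : forall k, Ckv k V F.
Hypothesis FS : forall u, V u -> dot (F u) (F u) = 1.
Hypothesis Ffree : forall u, V u -> row_free (tangent_frame F u).
Hypothesis CF1 : forall k, Ckv k U F1.
Hypothesis F1S : forall u, U u -> dot (F1 u) (F1 u) = 1.
Hypothesis F1free : forall u, U u -> row_free (tangent_frame F1 u).
Hypothesis Cphi : Ckv 2 U phi.
Hypothesis phiV : forall u, U u -> V (phi u).
Hypothesis F1E : forall u, U u -> F1 u = F (phi u).

Let J u : 'M[R]_m := \matrix_(i, a) (partial i phi u) 0 a.

Lemma partial_reparam u i : U u ->
  partial i F1 u = \sum_a J u i a *: partial a F (phi u).
Proof.
move=> Uu; rewrite (partial_congr i Uo F1E Uu).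
have dphi := Ckv_derivable (i := i) Cphi Uu.
have [_ D] := is_derive_chain Vo (CF 1) (phiV Uu) dphi.
apply: etrans D _; apply: eq_bigr => a _; rewrite mxE //.
Qed.

Lemma partial2_reparam u i j : U u ->
  partial i (partial j F1) u =
  \sum_a (partial i (fun y => J y j a) u *: partial a F (phi u)
          + J u j a *: \sum_b J u i b *: partial b (partial a F) (phi u)).
Proof.
move=> Uu; rewrite (partial_congr i Uo (fun y Uy => partial_reparam j Uy) Uu).
have dphi := Ckv_derivable (i := i) Cphi Uu.
have dJ a : is_derive u (delta_mx 0 i) (fun y => J y j a) (partial i (fun y => J y j a) u).
  apply: derivableP; rewrite (_ : (fun y => _) = fun y => partial j phi y 0 a).
    exact: Ck_derivable (Ckv_partial j Uo Cphi a) Uu.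
  by apply/funext => y; rewrite mxE.
have dF a := is_derive_chain Vo (Ckv_partial a Vo (CF 2)) (phiV Uu) dphi.
have D a := is_derive_scale (dJ a) (dF a).
have [_ DS] := is_derive_sum D.
rewrite (_ : (fun y => _) = \sum_a (fun y => J y j a *: (partial a F \o phi) y)).
  apply: etrans DS _; apply: eq_bigr => a _; congr (_ + _ *: _).
  by apply: eq_bigr => b _; rewrite mxE.
by apply/funext => y; rewrite fct_sumE.
Qed.

Lemma tangent_frame_reparam u : U u ->
  tangent_frame F1 u = J u *m tangent_frame F (phi u).
Proof.
move=> Uu; apply/row_matrixP => i; rewrite rowK partial_reparam //.
rewrite row_mul mulmx_sum_row; apply: eq_bigr => a _.
by rewrite [row i (J u) 0 a]mxE rowK.
Qed.

(** The frame of [F1] has rank [m] and factors through [J]. *)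
Lemma reparam_unit u : U u -> J u \in unitmx.
Proof.
move=> Uu; rewrite -row_full_unit.
have := F1free Uu; rewrite tangent_frame_reparam // /row_free /row_full => /eqP rk.
by rewrite eqn_leq rank_leq_row /= -[X in (X <= _)%N]rk mxrankM_maxl.
Qed.

Lemma first_form_reparam u : U u ->
  first_form F1 u = J u *m first_form F (phi u) *m (J u)^T.
Proof.
move=> Uu; rewrite first_formE tangent_frame_reparam // first_formE.
by rewrite trmx_mul !mulmxA.
Qed.

Lemma inv_first_form_reparam u : U u ->
  (J u)^T *m invmx (first_form F1 u) *m J u = invmx (first_form F (phi u)).
Proof.
move=> Uu; rewrite first_form_reparam // congr_invmx ?reparam_unit //.
by apply: (first_form_unit Ffree); exact: phiV.
Qed.

Lemma normal_proj_reparam u w : U u ->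
  normal_proj F1 u w = normal_proj F (phi u) w.
Proof.
move=> Uu.
have A (T : 'M[R]_(m, n.+1)) g : w *m T^T *m g *m T = w *m (T^T *m g *m T).
  by rewrite !mulmxA.
apply: etrans (normal_projE F1 u w) (etrans _ (esym (normal_projE F (phi u) w))).
rewrite (F1E Uu) !A.
rewrite -(inv_first_form_reparam Uu) (tangent_frame_reparam Uu) trmx_mul.
by rewrite !mulmxA.
Qed.

Lemma normal_projD u w1 w2 :
  normal_proj F u (w1 + w2) = normal_proj F u w1 + normal_proj F u w2.
Proof.
rewrite !normal_projE !mulmxDl /sphere_proj dotDl scalerDl !opprD.
by rewrite [in RHS]addrACA; congr (_ + _); rewrite addrACA.
Qed.

Lemma normal_projZ u a w : normal_proj F u (a *: w) = a *: normal_proj F u w.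
Proof.
by rewrite !normal_projE -!scalemxAl /sphere_proj dotZl -scalerA !scalerBr.
Qed.

Lemma normal_proj_sum u (I : finType) (w : I -> 'rV[R]_n.+1) :
  normal_proj F u (\sum_i w i) = \sum_i normal_proj F u (w i).
Proof.
elim/big_rec2: _ => [|i y z _ <-]; last exact: normal_projD.
by rewrite -[X in normal_proj F u X](scale0r 0) normal_projZ scale0r.
Qed.

Lemma normal_proj_partial u a : V u -> normal_proj F u (partial a F u) = 0.
Proof.
move=> Vu; rewrite normal_projE sphere_proj_id ?(dot_partial_F Vo CF FS) //.
have -> : partial a F u = row a (tangent_frame F u) by rewrite rowK.
rewrite -!row_mul -first_formE mulmxV ?mul1mx ?subrr //.
exact: (first_form_unit Ffree).
Qed.

(** The second derivatives of the change of chart come with tangent vectors, which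
    the normal projection kills: the second fundamental form is a tensor. *)
Lemma second_form_reparam u i j : U u -> second_form F1 u i j =
  \sum_a \sum_b (J u i b * J u j a) *: second_form F (phi u) b a.
Proof.
move=> Uu; have Vu := phiV Uu.
rewrite (second_formE Uo CF1 F1S) // normal_proj_reparam // partial2_reparam //.
rewrite normal_proj_sum; apply: eq_bigr => a _.
rewrite normal_projD !normal_projZ normal_proj_partial // scaler0 add0r.
rewrite normal_proj_sum scaler_sumr; apply: eq_bigr => b _.
by rewrite normal_projZ scalerA mulrC (second_formE Vo CF FS).
Qed.

Lemma mean_curvature_reparam u : U u ->
  mean_curvature F1 u = mean_curvature F (phi u).
Proof.
move=> Uu; rewrite /mean_curvature /metric_trace -(inv_first_form_reparam Uu).
apply: (congr1 ( *:%R m%:R^-1)).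
exact: congr_trace (fun i j => second_form_reparam i j Uu).
Qed.

End Reparametrization.

(** * Bochner's formula for the mean curvature vector *)

Section Bochner.
Variables (R : realType) (m n : nat) (V : set 'rV[R]_m).
Variable F : 'rV[R]_m -> 'rV[R]_n.+1.
Hypothesis Vo : open V.
Hypothesis CF : forall k, Ckv k V F.
Hypothesis FS : forall u, V u -> dot (F u) (F u) = 1.
Hypothesis Ffree : forall u, V u -> row_free (tangent_frame F u).
Local Notation G := (first_form F).
Local Notation tau := (tension (first_form F) F).
Local Notation tau2 u := (dot (tau u) (tau u)).
Local Notation tau2f := (fun u => tau2 u).
Local Notation drift := (laplace_drift F).
Local Notation A2 u := (\tr (shape_form F u *m invmx (G u) *m
   (shape_form F u *m invmx (G u)))).
Local Notation N2 u := (\tr (invmx (G u) *m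
   (normal_nabla_tau F u *m (normal_nabla_tau F u)^T))).

Lemma bochner u : V u -> bitension G F u = 0 ->
  elliptic_op (fun y => invmx (G y)) drift tau2f u = 2 * (A2 u - m%:R * tau2 u + N2 u).
Proof.
move=> Vu bi.
rewrite (laplace_sqr_tau Vo CF FS Ffree Vu bi) (grad_tau_sqrE Vo CF FS Ffree Vu).
by rewrite addrAC.
Qed.

Lemma normal_part_ge0 u : V u -> 0 <= N2 u.
Proof. by move=> Vu; rewrite first_formE tr_invgram_ge0 //; exact: Ffree. Qed.

Lemma sqnorm_AHE u : V u -> sqnorm_AH F u = m%:R^-1 ^+ 2 * A2 u.
Proof.
move=> Vu; rewrite /sqnorm_AH.
have -> : weingarten F u (mean_curvature F u) =
    m%:R^-1 *: (shape_form F u *m invmx (G u)).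
  rewrite /weingarten scalemxAl; congr (_ *m _); apply/matrixP => i j.
  by rewrite !mxE (mean_curvatureE Vo CF FS Vu) dotZr.
by rewrite -scalemxAl -scalemxAr scalerA mxtraceZ expr2.
Qed.

Lemma sqr_mean_curvatureE u : V u ->
  dot (mean_curvature F u) (mean_curvature F u) = m%:R^-1 ^+ 2 * tau2 u.
Proof.
by move=> Vu; rewrite (mean_curvatureE Vo CF FS Vu) dotZl dotZr mulrA expr2.
Qed.

Lemma tr_shape u : V u -> \tr (shape_form F u *m invmx (G u)) = tau2 u.
Proof.
move=> Vu.
have -> : tau2 u = dot (metric_trace (G u) (second_form F u)) (tau u).
  by rewrite -(tensionE Vo CF FS Vu).
rewrite dot_metric_trace.
apply: eq_bigr => i _; rewrite mxE; apply: eq_bigr => j _.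
by rewrite [shape_form F u i j]mxE mulrC -[in LHS](inv_first_form_sym F) mxE.
Qed.

Lemma sqr_tau2_le u : V u -> tau2 u ^+ 2 <= m%:R * A2 u.
Proof.
move=> Vu; rewrite -tr_shape // first_formE.
apply: sqr_tr_invgram; first exact: Ffree.
exact: (shape_form_sym Vo CF FS).
Qed.

Lemma normal_nabla_mean_curvature u i : V u ->
  normal_nabla F i (mean_curvature F) u = m%:R^-1 *: normal_nabla F i tau u.
Proof.
move=> Vu; rewrite /normal_nabla /pullback_nabla.
rewrite (partial_congr i Vo (fun y Vy => mean_curvatureE Vo CF FS Vy) Vu).
have -> : partial i (fun y => m%:R^-1 *: tau y) u = m%:R^-1 *: partial i tau u.
  have D := Ckv_derivable (i := i) (Ckv_tau Vo CF Ffree 1) Vu.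
  exact: deriveZ D.
have -> (w : 'rV[R]_n.+1) : sphere_proj (F u) (m%:R^-1 *: w) = m%:R^-1 *: sphere_proj (F u) w.
  by rewrite /sphere_proj dotZl scalerBr scalerA.
exact: normal_projZ.
Qed.

Lemma parallel_of_normal_part u i : V u -> N2 u = 0 ->
  normal_nabla F i (mean_curvature F) u = 0.
Proof.
move=> Vu; rewrite first_formE => /(tr_invgram_eq0 (Ffree Vu)) /(congr1 (row i)).
by rewrite rowK row0 normal_nabla_mean_curvature // => ->; rewrite scaler0.
Qed.

(** Under the pinching hypothesis Bochner's formula makes [|tau|^2] subharmonic. *)
Lemma tau2_local_max u0 :
  (forall u, V u -> bitension G F u = 0) ->
  (forall u, V u -> m%:R * tau2 u <= A2 u) ->
  V u0 -> (forall u, V u -> tau2 u <= tau2 u0) ->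
  \forall u \near u0, tau2 u = tau2 u0.
Proof.
move=> bi ge Vu0 umax.
pose Q y := invmx (tangent_frame F y *m (tangent_frame F y)^T) *m tangent_frame F y.
apply: (@strong_max R m V (fun y => invmx (G y)) drift n.+1 Q tau2f u0 Vo) => //.
- exact: Ck_dot Vo (Ckv_tau Vo CF Ffree 2) (Ckv_tau Vo CF Ffree 2).
- exact: Ck_inv_first_form Vo CF Ffree 0.
- move=> k; apply: CkN Vo _; apply: Ck_sum Vo _ => i; apply: Ck_sum Vo _ => j.
  exact: CkM Vo (Ck_inv_first_form Vo CF Ffree 0 i j) (Ck_christoffel Vo CF Ffree 0 k i j).
- by move=> y Vy; rewrite first_formE (invgramE (Ffree Vy)).
- by move=> y z Vy z0; rewrite first_formE; exact: invgram_pos (Ffree Vy) z z0.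
- move=> y Vy; rewrite bochner //; last exact: bi.
  by rewrite mulr_ge0 // addr_ge0 ?normal_part_ge0 // subr_ge0 ge.
Qed.

(** The Laplacian of a constant vanishes, and Bochner's formula leaves a vanishing
    sum of two nonnegative terms. *)
Lemma constant_tau2 c u : V u -> bitension G F u = 0 ->
  m%:R * tau2 u <= A2 u -> (forall y, V y -> tau2 y = c) ->
  A2 u = m%:R * tau2 u /\ N2 u = 0.
Proof.
move=> Vu bi ge tc.
have L0 : elliptic_op (fun y => invmx (G y)) drift tau2f u = 0.
  have p1 k y : V y -> partial k tau2f y = 0.
    by move=> Vy; rewrite (partial_congr k Vo tc Vy) partial_cst.
  rewrite /elliptic_op big1 ?add0r => [|i _].
    by rewrite big1 // => k _; rewrite p1 // mulr0.
  rewrite big1 // => j _.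
  by rewrite (partial_congr i Vo (fun y Vy => p1 j y Vy) Vu) partial_cst mulr0.
have := bochner Vu bi; rewrite L0.
have := normal_part_ge0 Vu; move: ge.
move: (A2 u) (N2 u) (m%:R * tau2 u) => a b t.
by move=> *; split; lra.
Qed.

End Bochner.

(** * From charts to the manifold *)

Section Manifold.
Variables (R : realType) (m n : nat) (M : smoothManifold R m).
Variable f : M -> 'rV[R]_n.+1.
Hypothesis fsub : sphere_submanifold f.

Lemma chart_Ckv c k : atlas c -> Ckv k (chart_cod c) (f \o chart_inv c).
Proof.
move=> ac; apply: smooth_on_Ckv (@chart_cod_open _ _ _ c) _.
by have [] := fsub.2 c ac.
Qed.

Lemma chart_sphere (c : chart R m M) u :
  chart_cod c u -> dot ((f \o chart_inv c) u) ((f \o chart_inv c) u) = 1.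
Proof.
by move=> _; rewrite -sqr_enorm; have := fsub.1 (chart_inv c u) => /= ->; rewrite expr1n.
Qed.

Lemma chart_free (c : chart R m M) u : atlas c -> chart_cod c u ->
  row_free (tangent_frame (f \o chart_inv c) u).
Proof. by move=> ac; have [_] := fsub.2 c ac; apply. Qed.

Lemma mean_curvature_chart (c d : chart R m M) p :
  atlas c -> atlas d -> chart_dom c p -> chart_dom d p ->
  mean_curvature (f \o chart_inv c) (chart_map c p) =
  mean_curvature (f \o chart_inv d) (chart_map d p).
Proof.
move=> ac ad cp dp.
pose U := [set u | chart_cod c u /\ chart_dom d (chart_inv c u)].
pose phi := chart_map d \o chart_inv c.
have Uo : open U.
  rewrite openE => u [cu du]; rewrite /interior.
  have n1 : nbhs u (chart_cod c).
    by apply: open_nbhs_nbhs; split => //; exact: chart_cod_open.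
  have n2 : nbhs u (chart_inv c @^-1` chart_dom d).
    apply: (chart_inv_continuous cu); apply: open_nbhs_nbhs; split => //.
    exact: chart_dom_open.
  by apply: filterS2 n1 n2 => y; split.
have Up : U (chart_map c p).
  by split; [exact: chart_map_cod|rewrite chart_mapK].
have Cphi : Ckv 2 U phi by apply: smooth_on_Ckv => //; exact: atlas_smooth.
have UC : U `<=` chart_cod c by move=> u [].
have := @mean_curvature_reparam R m n U (chart_cod d) (f \o chart_inv d)
  (f \o chart_inv c) phi Uo (@chart_cod_open _ _ _ d)
  (fun k => chart_Ckv k ad) (@chart_sphere d) (fun u du => chart_free ad du)
  (fun k j => Ck_sub UC (chart_Ckv k ac j)) (fun u Uu => chart_sphere (UC u Uu))
  (fun u Uu => chart_free ac (UC u Uu)) Cphi.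
move=> /(_ _ _ (chart_map c p) Up) ->.
- by rewrite /phi /= chart_mapK.
- by move=> u [_ du]; exact: chart_map_cod.
- by move=> u [_ du]; rewrite /phi /= chart_mapK.
Qed.

(** [|H|^2], read at each point in some chart around it. *)
Definition sqr_mean_curvature (p : M) : R :=
  let c := sval (cid2 (atlas_cover p)) in
  dot (mean_curvature (f \o chart_inv c) (chart_map c p))
      (mean_curvature (f \o chart_inv c) (chart_map c p)).

Lemma sqr_mean_curvatureP (c : chart R m M) p : atlas c -> chart_dom c p ->
  sqr_mean_curvature p =
  dot (mean_curvature (f \o chart_inv c) (chart_map c p))
      (mean_curvature (f \o chart_inv c) (chart_map c p)).
Proof.
move=> ac cp; rewrite /sqr_mean_curvature; case: cid2 => d ad dp /=.
by rewrite (mean_curvature_chart ad ac dp cp).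
Qed.

Local Notation tau c := (tension (induced_metric f c) (f \o chart_inv c)).

Lemma sqr_mean_curvature_tau (c : chart R m M) u : atlas c -> chart_cod c u ->
  sqr_mean_curvature (chart_inv c u) = m%:R^-1 ^+ 2 * dot (tau c u) (tau c u).
Proof.
move=> ac cu; rewrite (sqr_mean_curvatureP ac (chart_inv_dom cu)) chart_invK //.
exact: (sqr_mean_curvatureE (@chart_cod_open _ _ _ c) (fun k => chart_Ckv k ac)
          (@chart_sphere c) cu).
Qed.

Lemma sqr_mean_curvature_continuous : continuous sqr_mean_curvature.
Proof.
move=> p; have [c ac cp] := atlas_cover p.
pose q u := m%:R^-1 ^+ 2 * dot (tau c u) (tau c u).
apply: (@continuous_congr _ _ (chart_dom c) (q \o chart_map c)) => //.
- exact: chart_dom_open.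
- move=> x cx; rewrite /= -{2}(chart_mapK cx) sqr_mean_curvature_tau //.
  exact: chart_map_cod.
apply: continuous_comp; first exact: chart_map_continuous.
have Vo := @chart_cod_open _ _ _ c.
have Ct : Ckv 0 (chart_cod c) (tau c).
  exact: (Ckv_tau Vo (fun k => chart_Ckv k ac) (fun u cu => chart_free ac cu) 0).
have Cq : Ck 0 (chart_cod c) q by exact: CkM Vo (Ck_cst 0 _ _) (Ck_dot Vo Ct Ct).
exact: Ck_cont Cq (chart_map_cod cp).
Qed.

Hypothesis Mcpt : compact [set: M].
Hypothesis fpb : proper_biharmonic f.

Lemma proper_dim_gt0 : (0 < m)%N.
Proof.
rewrite lt0n; apply/negP => /eqP m0; apply: fpb.2 => c u _ _.
rewrite /tension /metric_trace big1 // => i _; exfalso.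
by move: (leq_ltn_trans (leq0n i) (ltn_ord i)); rewrite m0.
Qed.

Lemma proper_inhabited : exists p : M, True.
Proof.
apply: contrapT => M0; apply: fpb.2 => c u _ _; exfalso; apply: M0.
by exists (chart_inv c u).
Qed.

(** The set where [|H|^2] is maximal is nonempty because [M] is compact, closed by
    continuity, and open by the strong maximum principle in charts; [M] is
    connected. *)
Lemma sqr_mean_curvature_constant :
  (forall c u, atlas c -> chart_cod c u ->
     m%:R * dot (mean_curvature (f \o chart_inv c) u) (mean_curvature (f \o chart_inv c) u)
       <= sqnorm_AH (f \o chart_inv c) u) ->
  exists h, forall p, sqr_mean_curvature p = h.
Proof.
move=> ge; have m0 : 0 < m%:R^-1 ^+ 2 :> R.
  by rewrite exprn_gt0 // invr_gt0 ltr0n proper_dim_gt0.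
have [p0 _] := proper_inhabited.
have [q _ qmax] : exists2 q, q \in [set: M] &
    forall t, t \in [set: M] -> sqr_mean_curvature t <= sqr_mean_curvature q.
  apply: compact_EVT_max => //; first by exists p0.
  by apply: continuous_subspaceT; exact: sqr_mean_curvature_continuous.
have {}qmax t : sqr_mean_curvature t <= sqr_mean_curvature q.
  by apply: qmax; rewrite inE.
pose B := [set p | sqr_mean_curvature p = sqr_mean_curvature q].
suff BT : B = [set: M].
  exists (sqr_mean_curvature q) => p.
  by have : B p by rewrite BT.
apply: (carrier_connected (s := M)).
- by exists q.
- exists B; last by rewrite setTI.
  rewrite openE => p Bp; have [c ac cp] := atlas_cover p.
  have Vo := @chart_cod_open _ _ _ c.
  have cu := chart_map_cod cp.
  have E u (Vu : chart_cod c u) := sqr_mean_curvature_tau ac Vu.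
  have E' y (cy : chart_dom c y) :=
    etrans (congr1 sqr_mean_curvature (esym (chart_mapK cy))) (E _ (chart_map_cod cy)).
  have eq_le_scaled (x y a b : R) : x = a -> y = b -> x <= y -> a <= b.
    by move=> -> ->.
  have CF := fun k => chart_Ckv k ac.
  have FS := @chart_sphere c.
  have Ffree := fun u (Vu : chart_cod c u) => chart_free ac Vu.
  have ge' u : chart_cod c u -> m%:R * dot (tau c u) (tau c u) <=
      \tr (shape_form (f \o chart_inv c) u *m invmx (first_form (f \o chart_inv c) u)
       *m (shape_form (f \o chart_inv c) u *m invmx (first_form (f \o chart_inv c) u))).
    move=> Vu; have := ge c u ac Vu.
    rewrite (sqnorm_AHE Vo CF FS Vu) (sqr_mean_curvatureE Vo CF FS Vu) mulrCA.
    by rewrite ler_pM2l.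
  have tmax u : chart_cod c u -> dot (tau c u) (tau c u) <=
      dot (tau c (chart_map c p)) (tau c (chart_map c p)).
    move=> Vu; rewrite -(ler_pM2l m0).
    have lequ : sqr_mean_curvature (chart_inv c u) <= sqr_mean_curvature p.
      by rewrite [leRHS]Bp.
    exact: eq_le_scaled (E u Vu) (E' p cp) lequ.
  have near_u := tau2_local_max Vo CF FS Ffree (fun u Vu => fpb.1 c u ac Vu) ge' cu tmax.
  have near_p : \forall y \near p, dot (tau c (chart_map c y)) (tau c (chart_map c y))
      = dot (tau c (chart_map c p)) (tau c (chart_map c p)).
    exact: (chart_map_continuous cp) near_u.
  have dom_p : \forall y \near p, chart_dom c y.
    exact: open_nbhs_nbhs (conj (@chart_dom_open _ _ _ c) cp).
  rewrite /interior; apply: filterS2 near_p dom_p => y ty cy.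
  exact: etrans (E' y cy) (etrans (congr1 ( *%R _) ty) (etrans (esym (E' p cp)) Bp)).
- exists B; last by rewrite setTI.
  apply: (@preimage_closed _ _ sqr_mean_curvature _ _ (@closed_eq _ (sqr_mean_curvature q))).
  by move=> x _; exact: sqr_mean_curvature_continuous.
Qed.

End Manifold.

Theorem theorem3p2 (R : realType) (m n : nat) (M : smoothManifold R m)
  (f : M -> 'rV[R]_n.+1) :
  compact [set: M] -> sphere_submanifold f -> proper_biharmonic f ->
  (exists (p : M) (c : chart R m M), [/\ atlas c, chart_dom c p &
      sqnorm_AH (f \o chart_inv c) (chart_map c p)
        < m%:R * enorm (mean_curvature (f \o chart_inv c) (chart_map c p)) ^+ 2])
  \/
  [/\ (forall (p : M) (c : chart R m M), atlas c -> chart_dom c p ->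
         sqnorm_AH (f \o chart_inv c) (chart_map c p)
           = m%:R * enorm (mean_curvature (f \o chart_inv c) (chart_map c p)) ^+ 2),
      parallel_mean_curvature f &
      (forall (p : M) (c : chart R m M), atlas c -> chart_dom c p ->
         0 < enorm (mean_curvature (f \o chart_inv c) (chart_map c p)) <= 1)].
Proof.
move=> Mcpt fsub fpb.
have [ex|nex] := pselect (exists (p : M) (c : chart R m M), [/\ atlas c, chart_dom c p &
      sqnorm_AH (f \o chart_inv c) (chart_map c p)
        < m%:R * enorm (mean_curvature (f \o chart_inv c) (chart_map c p)) ^+ 2]).
  by left.
right.
have ge c u : atlas c -> chart_cod c u ->
    m%:R * dot (mean_curvature (f \o chart_inv c) u) (mean_curvature (f \o chart_inv c) u)
     <= sqnorm_AH (f \o chart_inv c) u.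
  move=> ac cu; rewrite leNgt; apply/negP => lt; apply: nex.
  exists (chart_inv c u), c; split => //; first exact: chart_inv_dom.
  by rewrite chart_invK // sqr_enorm.
have [h hE] := sqr_mean_curvature_constant fsub Mcpt fpb ge.
have m0 : 0 < m%:R :> R by rewrite ltr0n (proper_dim_gt0 fpb).
have mV0 : 0 < m%:R^-1 ^+ 2 :> R by rewrite exprn_gt0 // invr_gt0.
pose t := m%:R ^+ 2 * h.
have tauE c u : atlas c -> chart_cod c u ->
    dot (tension (induced_metric f c) (f \o chart_inv c) u)
        (tension (induced_metric f c) (f \o chart_inv c) u) = t.
  move=> ac cu; have := sqr_mean_curvature_tau fsub ac cu.
  rewrite hE => hE'; rewrite /t hE' mulrA -exprMn divff ?gt_eqF //.
  by rewrite expr1n mul1r.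
have t_gt0 : 0 < t.
  rewrite lt_neqAle; apply/andP; split; last first.
    have [p _] := proper_inhabited fpb; have [c ac cp] := atlas_cover p.
    by rewrite -(tauE c (chart_map c p) ac (chart_map_cod cp)) dot_ge0.
  apply/negP => /eqP t0; apply: fpb.2 => c u ac cu.
  by apply: dot_eq0; rewrite tauE.
have main c u : atlas c -> chart_cod c u ->
    [/\ sqnorm_AH (f \o chart_inv c) u
           = m%:R * enorm (mean_curvature (f \o chart_inv c) u) ^+ 2,
        forall i, normal_nabla (f \o chart_inv c) i
           (mean_curvature (f \o chart_inv c)) u = 0 &
        0 < enorm (mean_curvature (f \o chart_inv c) u) <= 1].
  move=> ac cu.
  have Vo := @chart_cod_open _ _ _ c.
  have CF := fun k => chart_Ckv fsub k ac.
  have FS := @chart_sphere _ _ _ _ _ fsub c.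
  have Ffree := fun u (Vu : chart_cod c u) => chart_free fsub ac Vu.
  have E1 := sqnorm_AHE Vo CF FS cu.
  have E2 := sqr_mean_curvatureE Vo CF FS cu.
  have ge' := ge c u ac cu; rewrite E1 E2 mulrCA ler_pM2l // in ge'.
  have [A2 N0] := constant_tau2 Vo CF FS Ffree cu (fpb.1 c u ac cu) ge'
    (fun y Vy => tauE c y ac Vy).
  have le := sqr_tau2_le Vo CF FS Ffree cu.
  rewrite A2 in le.
  have tE : dot (tension (first_form (f \o chart_inv c)) (f \o chart_inv c) u)
    (tension (first_form (f \o chart_inv c)) (f \o chart_inv c) u) = t := tauE c u ac cu.
  rewrite tE in le.
  split; first by rewrite sqr_enorm E1 E2 A2 mulrCA.
  - by move=> i; exact: (parallel_of_normal_part Vo CF FS Ffree i cu N0).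
  - have e0 : 0 <= enorm (mean_curvature (f \o chart_inv c) u) by exact: sqrtr_ge0.
    have e2 := sqr_enorm (mean_curvature (f \o chart_inv c) u).
    rewrite E2 tE in e2.
    apply/andP; split.
      by rewrite lt_neqAle e0 andbT eq_sym -sqrf_eq0 e2 gt_eqF // mulr_gt0.
    rewrite -(ler_pXn2r (n := 2)) // ?nnegrE // expr1n e2.
    rewrite exprVn mulrC ler_pdivrMr ?exprn_gt0 // mul1r.
    by rewrite -(ler_pM2l t_gt0) -expr2 (le_trans le) // mulrA -expr2 mulrC.
split.
- move=> p c ac cp; have [] := main c (chart_map c p) ac (chart_map_cod cp).
  by [].
- by move=> c u i ac cu; have [_ /(_ i)] := main c u ac cu.
- by move=> p c ac cp; have [_ _] := main c (chart_map c p) ac (chart_map_cod cp).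
Qed.
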